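(* There is a universal constant $C>0$ such that the following holds. Let $n\ge2$, $\epsilon\ge0$, and let $\mathcal S=(\tau^A,\tau^B,\ket\psi\in\mathcal H_A\otimes\mathcal H_B)$ be a strategy for the $n$-qubit LWPBT with winning probability $1-\epsilon$. Then there exist finite-dimensional Hilbert spaces $\mathcal H_A^{aux},\mathcal H_B^{aux}$, isometries $V_A:\mathcal H_A\to(\mathbb C^2)^{\otimes n}\otimes\mathcal H_A^{aux}$, $V_B:\mathcal H_B\to(\mathbb C^2)^{\otimes n}\otimes\mathcal H_B^{aux}$, and a unit vector $\ket{aux}\in\mathcal H_A^{aux}\otimes\mathcal H_B^{aux}$ such that $$\big\|(V_A\otimes V_B)\big((f_A(g)\otimes\mathbb 1_{\mathcal H_B})\ket\psi\big)-\big((\sigma(g)\otimes\mathbb 1)\ket{\Phi^{\otimes n}_{\mathrm{EPR}}}\big)\otimes\ket{aux}\big\|^2\le Cn^{12}\sqrt\epsilon$$ for all $g\in H(n)$, where the tensor factors on the left are reordered to $((\mathbb C^2)^{\otimes n}\otimes(\mathbb C^2)^{\otimes n})\otimes(\mathcal H_A^{aux}\otimes\mathcal H_B^{aux})$.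
   Context: LWPBT (low-weight Pauli braiding test): with probability $1/2$ each, the verifier plays (i) the low-weight linearity test: for $W\in\{X,Z\}^n$, $a\in\{0,1\}^n$, $W(a)\in\{I,X,Z\}^n$ has entry $W_i$ where $a_i=1$ and $I$ elsewhere; uniform $W$, $a,a'$ of Hamming weight $\le6$; Bob gets $(W(a),W(a'))$, answers bits $(b_1,b_2)$; Alice gets a uniform element of $\{W(a),W(a'),W(a+a')\}$ (if $|a+a'|\le6$) or of $\{W(a),W(a')\}$, answers a bit $c$; win iff $c=b_1$, $b_2$, $b_1+b_2$ respectively; or (ii) the low-weight anti-commutation test: uniform $a$ with ones exactly at $i<j$, uniform Magic Square row/column $q$ (variables $v_1..v_9$ row-major in a $3\times 3$ array; each row/column must sum to 0 mod 2 except the third column which must sum to 1) and uniform $v_k\in q$; Bob gets $(q,a)$ and answers an assignment to $q$; if $k\ne9$ Alice gets the string with $P$ at $i$, $Q$ at $j$, $I$ elsewhere where $A_k=\sigma_P\otimes\sigma_Q$ with $A_1=\sigma_I\otimes\sigma_Z,A_2=\sigma_Z\otimes\sigma_I,A_3=\sigma_Z\otimes\sigma_Z,A_4=\sigma_X\otimes\sigma_I,A_5=\sigma_I\otimes\sigma_X,A_6=\sigma_X\otimes\sigma_X,A_7=\sigma_X\otimes\sigma_Z,A_8=\sigma_Z\otimes\sigma_X$; if $k=9$ Alice gets $(v_9,a)$; win iff Bob's assignment satisfies $q$ and Alice's bit equals Bob's value of $v_k$. Alice's measurement depends only on the question she receives. Strategies use projective measurements; $\tau^A(x)=E^x_0-E^x_1$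 for Alice's PVM on $x$; for Bob's linearity question $y=(W(a),W(a'))$ with PVM $\{F^y_{b_1b_2}\}$, $\tau^B_y(W(a))=\sum(-1)^{b_1}F^y_{b_1b_2}$. $\tau^A_W(e_i)=\tau^A(I^{i-1}WI^{n-i})$, $\tau^B_W(e_i)=\tau^B_y(I^{i-1}WI^{n-i})$ with $y=(I^{i-1}WI^{n-i},I^n)$. $H(n)$ is the group generated by $J,X_i,Z_i$ with $J$ central, $J^2=X_i^2=Z_i^2=1$, $[X_i,Z_i]=J$, and $X_i,X_j$, $Z_i,Z_j$, $X_i,Z_j$ commuting for $i\ne j$. Normal form $J^\alpha X_{i_1}\cdots X_{i_k}Z_{j_1}\cdots Z_{j_l}$ ($i_1<\dots<i_k$, $j_1<\dots<j_l$). $f_P$ ($P\in\{A,B\}$) sends this element to $(-1)^\alpha\tau^P_X(e_{i_1})\cdots\tau^P_X(e_{i_k})\tau^P_Z(e_{j_1})\cdots\tau^P_Z(e_{j_l})$. $\sigma:H(n)\to\mathscr U((\mathbb C^2)^{\otimes n})$ is the representation with $\sigma(J)=-\mathbb 1$ and $\sigma(X_i),\sigma(Z_i)$ the Paulis $\sigma_X,\sigma_Z$ on qubit $i$. $\ket{\Phi_{\mathrm{EPR}}^{\otimes n}}\in(\mathbb C^2)^{\otimes n}\otimes(\mathbb C^2)^{\otimes n}$ is $n$ EPR pairs $(\ket{00}+\ket{11})/\sqrt2$, the $i$-th pair formed by the $i$-th qubits of the two factors. *)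

(* Defs.v *)
(* Scalars: the complex numbers, realized as R[i] over
   Stdlib's real numbers R (a realType via Rstruct). *)
From mathcomp Require Import all_boot all_order all_algebra.
From mathcomp Require Import complex.
From mathcomp Require Import Rstruct.
From Stdlib Require Import Rdefinitions.
Set Implicit Arguments. Unset Strict Implicit. Unset Printing Implicit Defensive.
Import GRing.Theory Num.Theory.
Local Open Scope ring_scope.

(* The field of complex numbers. *)
Definition CC : numClosedFieldType := (Rdefinitions.R)[i].

(* Finite-dimensional linear algebra on spaces C^I with an explicit   *)
(* finite basis type I; tensor products are products of basis types.  *)
Definition vec (I : finType) := I -> CC.
Definition mx (I J : finType) := I -> J -> CC.

Definition mid (I : finType) : mx I I := fun i j => (i == j)%:R.
Arguments mid I : clear implicits.
Definition mmul (I J K : finType) (A : mx I J) (B : mx J K) : mx I K :=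
  fun i k => \sum_(j : J) A i j * B j k.
Definition mapp (I J : finType) (A : mx I J) (v : vec J) : vec I :=
  fun i => \sum_(j : J) A i j * v j.
(* Kronecker / tensor product A (x) B on C^(I1*I2) *)
Definition tens (I1 J1 I2 J2 : finType) (A : mx I1 J1) (B : mx I2 J2)
  : mx (I1 * I2)%type (J1 * J2)%type := fun p q => A p.1 q.1 * B p.2 q.2.
(* <v|w> *)
Definition inner (I : finType) (v w : vec I) : CC := \sum_(i : I) (v i)^* * w i.
(* squared Euclidean norm ||v||^2 *)
Definition vnorm2 (I : finType) (v : vec I) : CC := \sum_(i : I) `|v i| ^+ 2.

(* V : C^J -> C^I is an isometry: V^* V = 1 *)
Definition is_isometry (I J : finType) (V : mx I J) : Prop :=
  forall c c' : J, \sum_(r : I) (V r c)^* * V r c' = mid J c c'.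

(* orthogonal projection: Hermitian and idempotent *)
Definition is_proj (I : finType) (P : mx I I) : Prop :=
  (forall i j, P i j = (P j i)^*) /\ (forall i j, mmul P P i j = P i j).
(* projective measurement (PVM) with outcome set O *)
Definition is_pvm (O I : finType) (P : O -> mx I I) : Prop :=
  (forall o, is_proj (P o)) /\ (forall i j, \sum_(o : O) P o i j = mid I i j).

(* uniform averages *)
Definition avgT (T : finType) (f : T -> CC) : CC :=
  (#|T|%:R)^-1 * \sum_(x : T) f x.
Definition avgS (T : finType) (A : {set T}) (f : T -> CC) : CC :=
  (#|A|%:R)^-1 * \sum_(x in A) f x.

(* Pauli strings and questions                                          *)
Inductive pauli := pI | pX | pZ.

(* strings in {I,X,Z}^n *)
Definition pstr (n : nat) := {ffun 'I_n -> pauli}.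
(* bit strings in {0,1}^n; also encode W in {X,Z}^n (false = X, true = Z) *)
Definition bits (n : nat) := {ffun 'I_n -> bool}.

Definition wt n (a : bits n) : nat := #|[pred i | a i]|.
Definition bxor n (a a' : bits n) : bits n := [ffun i => addb (a i) (a' i)].
Definition lowwt n : {set bits n} := [set a : bits n | leq (wt a) 6].

(* W(a) *)
Definition Wstr n (W a : bits n) : pstr n :=
  [ffun i => if a i then (if W i then pZ else pX) else pI].
(* I^{i-1} P I^{n-i} *)
Definition single n (i : 'I_n) (P : pauli) : pstr n :=
  [ffun t => if t == i then P else pI].
(* the string with P at i, Q at j, I elsewhere *)
Definition two_str n (i j : 'I_n) (P Q : pauli) : pstr n :=
  [ffun t => if t == i then P else if t == j then Q else pI].

(* Magic square: variable v_{3r+c+1} is (r,c) : 'I_3 * 'I_3 (row-major).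
   A line q is (false, r) = row r or (true, c) = column c. *)
Definition msvar := ('I_3 * 'I_3)%type.
Definition msline := (bool * 'I_3)%type.
(* the t-th variable of line q *)
Definition var_of (q : msline) (t : 'I_3) : msvar :=
  if q.1 then (t, q.2) else (q.2, t).
(* required parity of line q: 1 for the third column, 0 otherwise *)
Definition line_parity (q : msline) : bool := q.1 && (nat_of_ord q.2 == 2)%N.
(* s : assignment to the three variables of q (in order) *)
Definition sat (q : msline) (s : {ffun 'I_3 -> bool}) : bool :=
  odd (\sum_(t < 3) (s t : nat)) == line_parity q.
Definition is_v9 (v : msvar) : bool :=
  (nat_of_ord v.1 == 2)%N && (nat_of_ord v.2 == 2)%N.
(* A_k = sigma_P (x) sigma_Q, returned as (P,Q), for k = 1..8 *)
Definition Apair (v : msvar) : pauli * pauli :=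
  match nat_of_ord v.1, nat_of_ord v.2 with
  | 0, 0 => (pI, pZ) | 0, 1 => (pZ, pI) | 0, 2 => (pZ, pZ)
  | 1, 0 => (pX, pI) | 1, 1 => (pI, pX) | 1, 2 => (pX, pX)
  | 2, 0 => (pX, pZ) | 2, 1 => (pZ, pX)
  | _, _ => (pI, pI) (* v_9 : not used *)
  end.

(* Strategies for the n-qubit LWPBT                                     *)
(* H_A = C^dA, H_B = C^dB.  Alice's measurement depends only on her
   question: a Pauli string x (PVM A_str x over answers bool), or a
   question (v9, a) with a = e_i + e_j (PVM A_v9 i j).  Bob: for a
   linearity question (x, x') the PVM B_lin x x' over (b1,b2); for an
   anti-commutation question (q, a), a = e_i + e_j, the PVM B_ac q i j
   over assignments to q.  Bit answers: false = 0, true = 1. *)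
Record strategy (n dA dB : nat) := Strategy {
  A_str : pstr n -> bool -> mx 'I_dA 'I_dA;
  A_v9  : 'I_n -> 'I_n -> bool -> mx 'I_dA 'I_dA;
  B_lin : pstr n -> pstr n -> bool * bool -> mx 'I_dB 'I_dB;
  B_ac  : msline -> 'I_n -> 'I_n -> {ffun 'I_3 -> bool} -> mx 'I_dB 'I_dB;
  st    : vec ('I_dA * 'I_dB)%type }.

Definition valid_strategy n dA dB (S : strategy n dA dB) : Prop :=
  [/\ (forall x, is_pvm (A_str S x)),
      (forall i j, is_pvm (A_v9 S i j)),
      (forall x x', is_pvm (B_lin S x x')),
      (forall q i j, is_pvm (B_ac S q i j)) &
      vnorm2 (st S) = 1].

Section Game.
Variables (n dA dB : nat) (S : strategy n dA dB).

(* <psi| E (x) F |psi> *)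
Definition prob (E : mx 'I_dA 'I_dA) (F : mx 'I_dB 'I_dB) : CC :=
  inner (st S) (mapp (tens E F) (st S)).

(* low-weight linearity test, for fixed W, a, a' *)
Definition lin_win (W a a' : bits n) : CC :=
  let x := Wstr W a in let x' := Wstr W a' in let x'' := Wstr W (bxor a a') in
  let F := B_lin S x x' in
  let p1 := \sum_(b : bool * bool) prob (A_str S x b.1) (F b) in
  let p2 := \sum_(b : bool * bool) prob (A_str S x' b.2) (F b) in
  let p3 := \sum_(b : bool * bool) prob (A_str S x'' (addb b.1 b.2)) (F b) in
  if leq (wt (bxor a a')) 6 then (p1 + p2 + p3) / 3%:R else (p1 + p2) / 2%:R.

Definition lin_test : CC :=
  avgT (fun W : bits n => avgS (lowwt n) (fun a => avgS (lowwt n) (fun a' =>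
    lin_win W a a'))).

(* low-weight anti-commutation test, for fixed i<j, line q, position t *)
Definition ac_win (i j : 'I_n) (q : msline) (t : 'I_3) : CC :=
  let v := var_of q t in
  let E := if is_v9 v then A_v9 S i j
           else A_str S (two_str i j (Apair v).1 (Apair v).2) in
  \sum_(s : {ffun 'I_3 -> bool} | sat q s) prob (E (s t)) (B_ac S q i j s).

Definition pairs : {set ('I_n * 'I_n)%type} := [set p : ('I_n * 'I_n)%type | ltn p.1 p.2].

Definition ac_test : CC :=
  avgS pairs (fun p => avgT (fun q : msline => avgT (fun t : 'I_3 =>
    ac_win p.1 p.2 q t))).

Definition winprob : CC := (lin_test + ac_test) / 2%:R.

(* tau^A(x) = E^x_0 - E^x_1 *)
Definition tauA (x : pstr n) : mx 'I_dA 'I_dA :=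
  fun r c => A_str S x false r c - A_str S x true r c.

End Game.

(* ordered product M_{i1} M_{i2} ... M_{ik} over i1 < ... < ik with sel *)
Definition mprod (I : finType) n (M : 'I_n -> mx I I) (sel : bits n) : mx I I :=
  \big[@mmul I I I / mid I]_(i < n | sel i) M i.

(* Element J^alpha X_{i1}..X_{ik} Z_{j1}..Z_{jl} of H(n) in normal form,
   encoded by (alpha, {i1..ik}, {j1..jl}). *)
Definition heis (n : nat) := (bool * bits n * bits n)%type.
Definition sgn (b : bool) : CC := if b then -1 else 1.

Definition fA n dA dB (S : strategy n dA dB) (g : heis n) : mx 'I_dA 'I_dA :=
  let: (alpha, x, z) := g in
  fun r c => sgn alpha *
    mmul (mprod (fun i => tauA S (single i pX)) x)
         (mprod (fun i => tauA S (single i pZ)) z) r c.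

(* (C^2)^{(x) n} with computational basis indexed by bits n (qubit i =
   coordinate i, |0> = false, |1> = true) *)
Definition sigX n (i : 'I_n) : mx (bits n) (bits n) :=
  fun r c => (r == [ffun t => if t == i then ~~ c t else c t])%:R.
Definition sigZ n (i : 'I_n) : mx (bits n) (bits n) :=
  fun r c => (r == c)%:R * (if c i then -1 else 1).
Definition sigma n (g : heis n) : mx (bits n) (bits n) :=
  let: (alpha, x, z) := g in
  fun r c => sgn alpha * mmul (mprod (@sigX n) x) (mprod (@sigZ n) z) r c.

(* n EPR pairs, the i-th pair formed by the i-th qubits of both factors *)
Definition epr n : vec (bits n * bits n)%type :=
  fun p => \prod_(i < n) ((p.1 i == p.2 i)%:R / sqrtC 2%:R).
Arguments epr n : clear implicits.

(* Main.v *)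
(* A state psi in H_A (x) H_B is read as a dA x dB matrix Psi on which Alice acts from the
   left and Bob, through transposes, from the right.

   Winning the game forces, for every question used, |A Psi - Psi N|^2 <= 384 n^12 eps for the
   observables A, N of the two players: a fixed pair of low-weight strings is asked with
   probability at least of order n^-12, the average over {X,Z}^n costing only a constant since a
   question on two qubits sees two coordinates. Since Bob's observables for a common question
   commute exactly, Alice's generators on different qubits approximately commute on Psi; the magic
   square makes X_i and Z_i approximately anticommute. Sorting words costs O(n^2) exchanges per
   inserted generator, so A(g) A(h) Psi is A(gh) Psi up to O(n^3) basic errors.

   As in the Gowers-Hatami theorem, V = 2^-n sum_h (sigma(h) (x) 1)|EPR> (x) A(h)^* is an exact
   isometry, because the Bell vectors are orthonormal. Expanding (V_A (x) V_B) A(g) Psi and the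
   ideal vector in products of Bell vectors, the squared error is the average over h, k of
   |A(h)^* A(g) Psi N(k) - (+-) A(h g k) Psi|^2. Finally, if n^12 sqrt eps > 1 the trivial bound 4
   is enough, and otherwise n^18 eps <= n^6 sqrt eps. *)
Require Import Defs.
From mathcomp Require Import all_boot all_order all_algebra.
From mathcomp Require Import complex ring zify.
Import Order.TTheory GRing.Theory Num.Theory.
Set Implicit Arguments. Unset Strict Implicit. Unset Printing Implicit Defensive.
Local Open Scope ring_scope.
Local Open Scope sesquilinear_scope.

(** * Frobenius norm and approximate equality *)

Section Closeness.
Variable C : numClosedFieldType.

Definition norm2 m n (U : 'M[C]_(m, n)) : C := \sum_i \sum_j `|U i j| ^+ 2.

Lemma norm2_ge0 m n (U : 'M[C]_(m, n)) : 0 <= norm2 U.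
Proof. by apply: sumr_ge0 => i _; apply: sumr_ge0 => j _; rewrite exprn_ge0. Qed.

Lemma norm2_trace m n (U : 'M[C]_(m, n)) : norm2 U = \tr (U *m U^t*).
Proof.
apply: eq_bigr => i _; rewrite mxE; apply: eq_bigr => j _.
by rewrite !mxE normCK.
Qed.

Lemma norm2_tr m n (U : 'M[C]_(m, n)) : norm2 U^T = norm2 U.
Proof.
rewrite /norm2 exchange_big; apply: eq_bigr => i _; apply: eq_bigr => j _.
by rewrite mxE.
Qed.

Lemma norm2Z m n (a : C) (U : 'M[C]_(m, n)) : norm2 (a *: U) = `|a| ^+ 2 * norm2 U.
Proof.
rewrite /norm2 mulr_sumr; apply: eq_bigr => i _; rewrite mulr_sumr.
by apply: eq_bigr => j _; rewrite mxE normrM exprMn.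
Qed.

Lemma norm2N m n (U : 'M[C]_(m, n)) : norm2 (- U) = norm2 U.
Proof. by rewrite -scaleN1r norm2Z normrN1 expr1n mul1r. Qed.

Lemma norm2_unitaryr m n (U : 'M[C]_(m, n)) (W : 'M_n) :
  W \is unitarymx -> norm2 (U *m W) = norm2 U.
Proof.
move=> uW; rewrite !norm2_trace trmx_mul map_mxM mulmxA -(mulmxA U).
by rewrite (unitarymxP uW) mulmx1.
Qed.

Lemma norm2_unitaryl m n (U : 'M[C]_(m, n)) (W : 'M_m) :
  W \is unitarymx -> norm2 (W *m U) = norm2 U.
Proof.
by move=> uW; rewrite -norm2_tr trmx_mul norm2_unitaryr ?trmx_unitary ?norm2_tr.
Qed.

Lemma unitary1 n : 1%:M \is @unitarymx C n n.
Proof. by apply/unitarymxP; rewrite trmx1 map_mx1 mulmx1. Qed.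

Lemma unitary_prod (I : Type) n (M : I -> 'M[C]_n) (r : seq I) :
  (forall i, M i \is unitarymx) -> \big[mulmx/1%:M]_(i <- r) M i \is unitarymx.
Proof.
move=> uM; elim/big_ind: _ => //; [exact: unitary1|exact: mul_unitarymx].
Qed.

(** Weighted parallelogram identity. Dropping the nonnegative second term gives the triangle
    inequality with weights [k] and [l], without extracting a square root. *)
Lemma norm2_weighted m n (k l : C) (U V : 'M[C]_(m, n)) :
  k \is Num.real -> l \is Num.real ->
  k * l * norm2 (U + V) + norm2 (l *: U - k *: V)
  = (k + l) * (l * norm2 U + k * norm2 V).
Proof.
move=> /CrealP kr /CrealP lr; rewrite /norm2 !mulr_sumr -!big_split mulr_sumr.
apply: eq_bigr => i _; rewrite !mulr_sumr -!big_split mulr_sumr /=.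
apply: eq_bigr => j _; rewrite !mxE !normCK !(rmorphD, rmorphN, rmorphM) /= kr lr.
ring.
Qed.

Lemma norm2_sub m n (U V : 'M[C]_(m, n)) :
  norm2 (U - V) <= 2%:R * (norm2 U + norm2 V).
Proof.
have := norm2_weighted U (- V) (rpred1 _) (rpred1 _).
rewrite !mul1r norm2N -[1 + 1]/(2%:R : C) => <-.
by rewrite lerDl norm2_ge0.
Qed.

Variable D : C.
Hypothesis D_ge0 : 0 <= D.

(* Distance at most [k * sqrt D], stated with squared norms so that no square root is needed. *)
Definition close (k : nat) m n (U V : 'M[C]_(m, n)) : Prop :=
  norm2 (U - V) <= (k ^ 2)%:R * D.

Lemma close_refl m n (U : 'M[C]_(m, n)) : close 0 U U.
Proof.
rewrite /close subrr mul0r /norm2 big1 // => i _; rewrite big1 // => j _.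
by rewrite mxE normr0 expr0n.
Qed.

Lemma close_sym k m n (U V : 'M[C]_(m, n)) : close k U V -> close k V U.
Proof. by rewrite /close -norm2N opprB. Qed.

Lemma close_le k l m n (U V : 'M[C]_(m, n)) :
  (k <= l)%N -> close k U V -> close l U V.
Proof.
move=> kl /le_trans; apply; apply: ler_wpM2r => //.
by rewrite ler_nat leq_sqr.
Qed.

Lemma close0_eq m n (U V : 'M[C]_(m, n)) : close 0 U V -> U = V.
Proof.
rewrite /close mul0r => h; apply/matrixP => i j; apply/eqP; rewrite -subr_eq0.
have : norm2 (U - V) == 0 by rewrite eq_le h norm2_ge0.
rewrite psumr_eq0 => [/allP/(_ i (mem_index_enum _))|]; last first.
  by move=> ? _; apply: sumr_ge0 => ? _; rewrite exprn_ge0.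
rewrite /= psumr_eq0 => [/allP/(_ j (mem_index_enum _))|]; last first.
  by move=> ? _; rewrite exprn_ge0.
by rewrite /= expf_eq0 /= normr_eq0 !mxE.
Qed.

Lemma close_trans k l m n (V U W : 'M[C]_(m, n)) :
  close k U V -> close l V W -> close (k + l) U W.
Proof.
(* The main argument divides by k l, so a zero bound is treated apart; it forces equality. *)
case: k => [/close0_eq -> //|k].
case: l => [h /close0_eq <-|l hk hl]; first by rewrite addn0.
rewrite /close; set kk := k.+1%:R : C; set ll := l.+1%:R : C.
have k0 : 0 < kk by rewrite ltr0Sn.
have l0 : 0 < ll by rewrite ltr0Sn.
have e : U - W = (U - V) + (V - W) by rewrite addrA subrK.
rewrite -(ler_pM2l (mulr_gt0 k0 l0)).
have h := norm2_weighted (U - V) (V - W) (gtr0_real k0) (gtr0_real l0).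
apply: (@le_trans _ _ ((kk + ll) * (ll * norm2 (U - V) + kk * norm2 (V - W)))).
  by rewrite -h -e lerDl norm2_ge0.
apply: (@le_trans _ _ ((kk + ll) * (ll * ((k.+1 ^ 2)%:R * D) + kk * ((l.+1 ^ 2)%:R * D)))).
  rewrite ler_pM2l ?addr_gt0 //; apply: lerD; rewrite ler_pM2l //.
rewrite !natrX natrD -/kk -/ll.
by rewrite le_eqVlt; apply/orP; left; apply/eqP; ring.
Qed.

Lemma close_mull k m n (M : 'M[C]_m) (U V : 'M[C]_(m, n)) :
  M \is unitarymx -> close k U V -> close k (M *m U) (M *m V).
Proof. by move=> uM; rewrite /close -mulmxBr norm2_unitaryl. Qed.

Lemma close_mulr k m n (M : 'M[C]_n) (U V : 'M[C]_(m, n)) :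
  M \is unitarymx -> close k U V -> close k (U *m M) (V *m M).
Proof. by move=> uM; rewrite /close -mulmxBl norm2_unitaryr. Qed.

Lemma close_sign k m n (b : bool) (U V : 'M[C]_(m, n)) :
  close k U V -> close k ((-1) ^+ b *: U) ((-1) ^+ b *: V).
Proof.
by rewrite /close -scalerBr norm2Z normrX normrN1 expr1n expr1n mul1r.
Qed.

End Closeness.

(** * Sorting words in the generators *)

Section Words.
Variable C : numClosedFieldType.

Definition slot n (M : 'M[C]_n) (b : bool) := if b then M else 1%:M.

(** The list fixes the order of the letters and [e] only switches them on or off, so all words over
    one list share one normal form. *)
Definition word (G : Type) n (M : G -> 'M[C]_n) (e : G -> bool) (L : seq G) :=
  \big[mulmx/1%:M]_(q <- L) slot (M q) (e q).

Lemma slot_unitary n (M : 'M[C]_n) b : M \is unitarymx -> slot M b \is unitarymx.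
Proof. by case: b => // _; exact: unitary1. Qed.

Lemma word_unitary (G : Type) n (M : G -> 'M[C]_n) e L :
  (forall p, M p \is unitarymx) -> word M e L \is unitarymx.
Proof. by move=> uM; apply: unitary_prod => q; exact: slot_unitary. Qed.

Lemma word_cons (G : Type) n (M : G -> 'M[C]_n) e q L :
  word M e (q :: L) = slot (M q) (e q) *m word M e L.
Proof. by rewrite /word big_cons. Qed.

Lemma word_cat (G : Type) n (M : G -> 'M[C]_n) e K L :
  word M e (K ++ L) = word M e K *m word M e L.
Proof.
elim: K => [|q K IH]; first by rewrite /word big_nil mul1mx.
by rewrite cat_cons !word_cons IH mulmxA.
Qed.

Lemma eq_word (G : eqType) n (M : G -> 'M[C]_n) e e' L :
  {in L, e =1 e'} -> word M e L = word M e' L.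
Proof. by move=> h; apply: eq_big_seq => q /h ->. Qed.

Variables (D : C) (G : eqType) (dA dB : nat).
Variables (M : G -> 'M[C]_dA) (N : G -> 'M[C]_dB) (Psi : 'M[C]_(dA, dB)).
Variables (an : rel G) (k0 : nat).
Hypotheses (D_ge0 : 0 <= D).
Hypotheses (uM : forall p, M p \is unitarymx) (uN : forall p, N p \is unitarymx).
Hypothesis M2 : forall p, M p *m M p = 1%:M.
Hypothesis consistent : forall p, close D 1 (M p *m Psi) (Psi *m N p).
Hypothesis swap : forall p q, p != q ->
  close D k0 (M p *m (M q *m Psi)) ((-1) ^+ an p q *: (M q *m (M p *m Psi))).

(** Letters cross [Psi] one at a time, the last one first, and each lands to the left of those
    already moved, so the order is kept. *)
Lemma word_consistent e L : close D (size L) (word M e L *m Psi) (Psi *m word N e L).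
Proof.
elim: L => [|q L IH]; first by rewrite /word !big_nil mul1mx mulmx1; exact: close_refl.
rewrite !word_cons -mulmxA /= -addn1.
apply: (close_trans (close_mull (slot_unitary _ (uM q)) IH)).
rewrite !mulmxA; apply: close_mulr; first exact: word_unitary.
case: (e q) => //=; rewrite mul1mx mulmx1.
by apply: (@close_le _ _ D_ge0 0) => //; exact: close_refl.
Qed.

(* The word standing between the two letters and [Psi] is parked on the right of [Psi]
   while they are exchanged. *)
Lemma word_swap e L p q : p != q ->
  close D (k0 + 2 * size L)
    (M p *m (slot (M q) (e q) *m (word M e L *m Psi)))
    ((-1) ^+ (an p q && e q) *: (slot (M q) (e q) *m (M p *m (word M e L *m Psi)))).
Proof.
move=> npq; case: (e q) => /=; last first.
  rewrite andbF expr0 scale1r !mul1mx.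
  by apply: (@close_le _ _ D_ge0 0) => //; exact: close_refl.
rewrite andbT.
have -> : (k0 + 2 * size L = size L + (k0 + size L))%N by lia.
have h := word_consistent e L.
apply: (close_trans (close_mull (uM p) (close_mull (uM q) h))).
apply: (@close_trans _ _ _ _ _ _ ((-1) ^+ an p q *: (M q *m (M p *m (Psi *m word N e L))))).
  rewrite !mulmxA scalemxAl; apply: close_mulr; first exact: word_unitary.
  by rewrite -!mulmxA; exact: swap.
apply: close_sign; apply: close_mull (uM q) (close_mull (uM p) _).
exact: close_sym.
Qed.

(** Sign collected by a letter [p] travelling rightwards to its own slot: only switched-on letters
    that anticommute with it count. *)
Fixpoint insert_sign (p : G) (e : G -> bool) (L : seq G) : bool :=
  if L is q :: L' then
    if q == p then false else (an p q && e q) (+) insert_sign p e L'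
  else false.

(** The letter walks to its own slot, where [M2] toggles the exponent. The bound [m] on the length
    keeps the cost per exchange fixed along the induction. *)
Lemma word_insert m e L p : p \in L -> uniq L -> (size L <= m)%N ->
  close D (size L * (k0 + 2 * m)) (M p *m (word M e L *m Psi))
    ((-1) ^+ insert_sign p e L *: (word M (fun q => e q (+) (q == p)) L *m Psi)).
Proof.
elim: L => // q L IH; rewrite inE /= => pL /andP[qL uL] sL.
rewrite !word_cons; have [qp|nqp] := eqVneq q p.
  rewrite expr0 scale1r -!mulmxA (@eq_word _ _ M _ e); last first.
    by move=> r rL /=; case: eqP => [rp|]; [move: qL; rewrite qp -rp rL|rewrite addbF].
  rewrite !mulmxA qp.
  have -> : M p *m slot (M p) (e p) = slot (M p) (e p (+) true).
    by case: (e p); rewrite /= ?M2 ?mulmx1.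
  by apply: (@close_le _ _ D_ge0 0) => //; exact: close_refl.
rewrite eq_sym (negbTE nqp) /= in pL.
rewrite addbF -!mulmxA mulSn.
have sL' : (k0 + 2 * size L <= k0 + 2 * m)%N by lia.
rewrite eq_sym in nqp.
apply: (close_trans (close_le D_ge0 sL' (word_swap e L nqp))).
rewrite signr_addb -scalerA; apply: close_sign.
rewrite scalemxAr; apply: close_mull; first exact: slot_unitary.
by apply: IH => //; lia.
Qed.

(** The letters of [t] are inserted from the last to the first. The hypothesis on [c] makes each
    sign independent of the exponents inside [t], as for a block of generators of one type. *)
Lemma word_mul (c : G -> bool) t L f e : uniq t -> {subset t <= L} -> uniq L ->
  (forall p e', p \in t -> (forall q, q \notin t -> e' q = e q) ->
     insert_sign p e' L = c p) ->
  close D (size t * (size L * (k0 + 2 * size L))) (word M f t *m (word M e L *m Psi))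
    ((-1) ^+ (\big[addb/false]_(p <- t) (f p && c p)) *:
       (word M (fun q => e q (+) (f q && (q \in t))) L *m Psi)).
Proof.
move=> + + uL; elim: t => [_ _ _|p t IH /= /andP[pt ut] tL hc].
  rewrite {1}/word !big_nil mul1mx expr0 scale1r (@eq_word _ _ M _ e); last first.
    by move=> q _ /=; rewrite in_nil andbF addbF.
  exact: close_refl.
rewrite word_cons -mulmxA mulSn addnC.
have tL' : {subset t <= L} by move=> q qt; apply: tL; rewrite inE qt orbT.
have {}IH := IH ut tL' _.
apply: (close_trans (close_mull (slot_unitary _ (uM p)) (IH _))).
  move=> q e' qt he'; apply: hc; first by rewrite inE qt orbT.
  by move=> r; rewrite inE negb_or => /andP[_ /he'].
rewrite big_cons addbC signr_addb -scalerA -scalemxAr; apply: close_sign.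
set e1 := fun q => e q (+) (f q && (q \in t)).
case fp: (f p) => /=; last first.
  rewrite mul1mx expr0 scale1r (@eq_word _ _ M _ e1); last first.
    by move=> q _; rewrite /e1 inE; case: eqP => // ->; rewrite fp.
  by apply: (@close_le _ _ D_ge0 0) => //; exact: close_refl.
rewrite -(hc p e1) ?mem_head //; last first.
  by move=> q; rewrite inE negb_or /e1 => /andP[_ /negbTE ->]; rewrite andbF addbF.
rewrite (@eq_word _ _ M (fun q => e q (+) (f q && (q \in p :: t))) (fun q => e1 q (+) (q == p))).
  by apply: word_insert => //; apply: tL; exact: mem_head.
move=> q _; rewrite /e1 inE; case: eqP => [->|] /=; last by rewrite addbF.
by rewrite fp (negbTE pt) /= addbF.
Qed.

End Words.

(** * Normal-form words in the generators of H(n) *)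

Definition dotb n (a b : bits n) : bool := \big[addb/false]_(i < n) (a i && b i).

Section PauliWords.
Variable C : numClosedFieldType.

(* [(false, i)] stands for the generator [X_i] and [(true, i)] for [Z_i]. *)
Definition gens n : seq (bool * 'I_n) :=
  [seq (false, i) | i <- enum 'I_n] ++ [seq (true, i) | i <- enum 'I_n].

Definition expo n (x z : bits n) (p : bool * 'I_n) : bool := if p.1 then z p.2 else x p.2.

Definition anti n : rel (bool * 'I_n) := fun p q => (p.1 != q.1) && (p.2 == q.2).

Definition pword n d (M : bool * 'I_n -> 'M[C]_d) (x z : bits n) := word M (expo x z) (gens n).

Lemma gens_uniq n : uniq (gens n).
Proof.
have inj (c : bool) : injective (@pair _ 'I_n c) by move=> i j [].
rewrite cat_uniq !(map_inj_uniq (inj _)) enum_uniq andbT /=; apply/hasPn => p /mapP[i _ ->]; apply/mapP => -[j _ h].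
by case: h.
Qed.

Lemma size_gens n : size (gens n) = (2 * n)%N.
Proof. by rewrite size_cat !(size_map (pair _)) size_enum_ord mul2n addnn. Qed.

Lemma insert_sign_X n (e : bool * 'I_n -> bool) (s : seq 'I_n) t i : i \in s ->
  insert_sign (@anti n) (false, i) e ([seq (false, j) | j <- s] ++ t) = false.
Proof.
elim: s => // j s IH; rewrite inE => /orP[/eqP <-|/IH {}IH] /=; first by rewrite eqxx.
by rewrite IH; case: ifP.
Qed.

(** A Z letter crosses the whole X block, where only the X letter on the same qubit anticommutes
    with it. *)
Lemma insert_sign_Z n (e : bool * 'I_n -> bool) (s t : seq 'I_n) i : uniq s ->
  insert_sign (@anti n) (true, i) e ([seq (false, j) | j <- s] ++ [seq (true, j) | j <- t])
  = (i \in s) && e (false, i).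
Proof.
elim: s => [_|j s IH /= /andP[js us]].
  by rewrite in_nil /=; elim: t => //= j t ->; case: eqP.
rewrite IH // inE /anti /=; case: (eqVneq i j) => //= ->.
by rewrite (negbTE js) addbF.
Qed.

Variables (D : C) (n dA dB : nat).
Variables (M : bool * 'I_n -> 'M[C]_dA) (N : bool * 'I_n -> 'M[C]_dB) (Psi : 'M[C]_(dA, dB)).
Variables (k0 : nat).
Hypotheses (D_ge0 : 0 <= D).
Hypotheses (uM : forall p, M p \is unitarymx) (uN : forall p, N p \is unitarymx).
Hypothesis M2 : forall p, M p *m M p = 1%:M.
Hypothesis consistent : forall p, close D 1 (M p *m Psi) (Psi *m N p).
Hypothesis swap : forall p q, p != q ->
  close D k0 (M p *m (M q *m Psi)) ((-1) ^+ anti p q *: (M q *m (M p *m Psi))).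

(** The Z block of the left word is inserted first and passes the X letters of the right word, which
    produces the sign; the X block then goes in without a sign. *)
Lemma pword_mul a b x z :
  close D (2 * n * (2 * n * (k0 + 2 * (2 * n))))
    (pword M a b *m (pword M x z *m Psi))
    ((-1) ^+ dotb b x *: (pword M (bxor a x) (bxor b z) *m Psi)).
Proof.
(* Each of the two blocks has [n] letters and costs [n * K]. *)
set K := (2 * n * (k0 + 2 * (2 * n)))%N.
have -> : (2 * n * K = n * K + n * K)%N by rewrite mul2n -addnn mulnDl.
rewrite {1}/pword {1}/gens word_cat -mulmxA.
have uniqX (c : bool) : uniq [seq (c, i) | i <- enum 'I_n].
  by rewrite map_inj_uniq ?enum_uniq // => i j [].
have memg (c c' : bool) (i : 'I_n) : ((c, i) \in [seq (c', i) | i <- enum 'I_n]) = (c == c').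
  apply/mapP/eqP => [[j _ [->]] // | ->]; exists i => //; exact: mem_enum.
have subg c : {subset [seq (c, i) | i <- enum 'I_n] <= gens n}.
  by move=> [c' i]; rewrite mem_cat !memg; case: c c' => -[].
have key c cs e0 := @word_mul C D _ _ _ M N Psi (@anti n) k0 D_ge0 uM uN M2 consistent swap cs
   _ (gens n) (expo a b) e0 (uniqX c) (subg c) (gens_uniq n).
have := key true (fun p => x p.2) (expo x z).
rewrite (size_map (pair _)) size_enum_ord size_gens => h.
apply: (close_trans (close_mull (word_unitary _ _ uM) (h _))) => {h}.
  move=> [c i] e'; rewrite memg => /eqP -> he'.
  by rewrite insert_sign_Z ?enum_uniq // mem_enum /= he' // memg.
rewrite -scalemxAr.
have -> : \big[addb/false]_(p <- [seq (true, i) | i <- enum 'I_n]) (expo a b p && x p.2)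
   = dotb b x by rewrite big_map big_enum.
apply: close_sign.
have := key false (fun=> false) (expo x (bxor b z)).
rewrite (size_map (pair _)) size_enum_ord size_gens.
rewrite big1 => [|p _]; last by rewrite andbF.
rewrite expr0 scale1r => h.
have -> : word M (fun q => expo x z q (+) (expo a b q && (q \in [seq (true, i) | i <- enum 'I_n]))) (gens n)
    = word M (expo x (bxor b z)) (gens n).
  by apply: eq_word => -[[] i] _ /=; rewrite memg /expo /= ?ffunE ?andbT ?andbF ?addbF 1?addbC.
have -> : pword M (bxor a x) (bxor b z) =
    word M (fun q => expo x (bxor b z) q (+) (expo a b q && (q \in [seq (false, i) | i <- enum 'I_n]))) (gens n).
  by apply: eq_word => -[[] i] _ /=; rewrite memg /expo /= ?ffunE ?andbT ?andbF ?addbF 1?addbC.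
apply: h => -[c i] e'; rewrite memg => /eqP -> _.
by rewrite insert_sign_X // mem_enum.
Qed.

Lemma pword_consistent x z : close D (2 * n) (pword M x z *m Psi) (Psi *m pword N x z).
Proof. by rewrite -size_gens; apply: word_consistent. Qed.

(* The three words are collected on the left of [Psi] up to the sign read off from
   [Z^b X^x = (-1)^(b.x) X^x Z^b]. *)
Lemma pword_conj_mul a b x z x' z' :
  close D (2 * n + 2 * (2 * n * (2 * n * (k0 + 2 * (2 * n)))))
    ((pword M x z)^t* *m (pword M a b *m (Psi *m pword N x' z')))
    ((-1) ^+ (dotb b x' (+) dotb z (bxor (bxor x a) x')) *:
       (pword M (bxor (bxor x a) x') (bxor (bxor z b) z') *m Psi)).
Proof.
have uw y w : pword M y w \is unitarymx by exact: word_unitary.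
set s := _ (+) _; set m := pword M (bxor (bxor x a) x') _.
(* The target is rewritten as W^* W times itself, with W = [pword M x z], so that the unitary W^*
   can be stripped from both sides. *)
have -> : (-1) ^+ s *: (m *m Psi) = (pword M x z)^t* *m ((-1) ^+ s *: (pword M x z *m (m *m Psi))).
  rewrite -scalemxAr [X in _ = _ *: X]mulmxA; congr (_ *: _).
  by rewrite mulmxA (mulmx1C (unitarymxP (uw x z))) mul1mx.
apply: close_mull; first by rewrite trmxC_unitary.
apply: (close_trans (close_mull (uw a b) (close_sym (pword_consistent x' z')))).
rewrite mul2n -addnn.
apply: (close_trans (pword_mul a b x' z')).
rewrite /s signr_addb -scalerA; apply: close_sign.
have := close_sign (dotb z (bxor (bxor x a) x')) (close_sym (pword_mul x z (bxor (bxor x a) x') (bxor (bxor z b) z'))).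
rewrite scalerA -signr_addb addbb expr0 scale1r -/m.
have b3 (u v w : bits n) : bxor u (bxor (bxor u v) w) = bxor v w.
  by apply/ffunP => i; rewrite !ffunE !addbA addbb addFb.
by rewrite !b3.
Qed.

End PauliWords.

(** * Characters of bit strings *)

Section BitStrings.
Variable n : nat.
Implicit Types a b c s z : bits n.

Definition bzero : bits n := [ffun=> false].

Lemma bxorC a b : bxor a b = bxor b a.
Proof. by apply/ffunP => i; rewrite !ffunE addbC. Qed.

Lemma bxorK b : involutive (fun a : bits n => bxor a b).
Proof. by move=> a; apply/ffunP => i; rewrite !ffunE -addbA addbb addbF. Qed.

Lemma bxor_eq0 a b : (bxor a b == bzero) = (a == b).
Proof.
apply/eqP/eqP => [/ffunP h|->]; apply/ffunP => i; last by rewrite !ffunE addbb.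
by have := h i; rewrite !ffunE; case: (a i) (b i) => -[].
Qed.

Lemma dotbC a b : dotb a b = dotb b a.
Proof. by apply: eq_bigr => i _; rewrite andbC. Qed.

Lemma dotb_xorl a b c : dotb (bxor a b) c = dotb a c (+) dotb b c.
Proof. by rewrite -big_split; apply: eq_bigr => i _; rewrite ffunE andb_addl. Qed.

Lemma dotb_xorr a b c : dotb a (bxor b c) = dotb a b (+) dotb a c.
Proof. by rewrite dotbC dotb_xorl !(dotbC a). Qed.

Lemma reindex_bxor (R : Type) (idx : R) (op : Monoid.com_law idx) b (F : bits n -> R) :
  \big[op/idx]_a F (bxor a b) = \big[op/idx]_a F a.
Proof. by rewrite [RHS](reindex_inj (inv_inj (bxorK b))). Qed.

End BitStrings.

Section Characters.
Variables (C : numClosedFieldType) (n : nat).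
Implicit Types a b s z : bits n.

Definition chi z s : C := (-1) ^+ dotb z s.

Lemma chiC z s : chi z s = chi s z. Proof. by rewrite /chi dotbC. Qed.

Lemma chi_xorl z z' s : chi (bxor z z') s = chi z s * chi z' s.
Proof. by rewrite /chi dotb_xorl signr_addb. Qed.

Lemma chi_xorr z s s' : chi z (bxor s s') = chi z s * chi z s'.
Proof. by rewrite /chi dotb_xorr signr_addb. Qed.

Lemma chi_conj z s : (chi z s)^* = chi z s.
Proof. by rewrite /chi rmorph_sign. Qed.

(** For nonzero [s], translating [z] by a unit vector at a coordinate where [s] is 1 negates the
    sum, which is therefore zero. *)
Lemma sum_chi s : \sum_z chi z s = (s == bzero n)%:R * 2%:R ^+ n.
Proof.
have [->|/eqP s0] := eqVneq s (bzero n).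
  rewrite mul1r (eq_bigr (fun=> 1)) => [|z _]; last first.
    by rewrite /chi /dotb big1 // => i _; rewrite ffunE andbF.
  by rewrite sumr_const card_ffun card_bool card_ord natrX.
rewrite mul0r; have [i si] : exists i, s i.
  apply/existsP/negP => /existsP h; apply: s0; apply/ffunP => i; rewrite ffunE.
  by apply/negP => si; apply: h; exists i.
pose e : bits n := [ffun j => j == i].
have ce : chi e s = -1.
  rewrite /chi /dotb (bigD1 i) //= big1 => [|j ji].
    by rewrite ffunE eqxx si.
  by rewrite ffunE (negbTE ji).
have : \sum_z chi z s = - \sum_z chi z s.
  rewrite -{1}(reindex_bxor _ e) -sumrN; apply: eq_bigr => z _.
  by rewrite chi_xorl ce mulrN1.
by move/eqP; rewrite -addr_eq0 -mulr2n mulrn_eq0 /= => /eqP.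
Qed.

Lemma chi_orth z z' : \sum_s chi z s * chi z' s = (z == z')%:R * 2%:R ^+ n.
Proof.
rewrite -bxor_eq0 -sum_chi; apply: eq_bigr => s _.
by rewrite -chi_xorl chiC.
Qed.

Lemma adjmx_sum (I : Type) (r : seq I) m k (F : I -> 'M[C]_(m, k)) :
  (\sum_(i <- r) F i)^t* = \sum_(i <- r) (F i)^t*.
Proof.
apply/matrixP => i j; rewrite !(mxE, summxE) rmorph_sum.
by apply: eq_bigr => l _; rewrite !mxE.
Qed.

Lemma adjmxZ m k (x : C) (U : 'M[C]_(m, k)) : (x *: U)^t* = x^* *: U^t*.
Proof. by apply/matrixP => i j; rewrite !mxE rmorphM. Qed.

(** Parseval is proved for Gram matrices, before any trace is taken, because the isometry condition
    is an operator identity. *)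
Lemma parseval_gram m k (F : bits n -> 'M[C]_(m, k)) :
  \sum_s (\sum_z chi z s *: F z)^t* *m (\sum_z chi z s *: F z)
  = 2%:R ^+ n *: \sum_z (F z)^t* *m F z.
Proof.
have e s : (\sum_z chi z s *: F z)^t* *m (\sum_z chi z s *: F z)
   = \sum_z \sum_z' (chi z s * chi z' s) *: ((F z)^t* *m F z').
  rewrite adjmx_sum mulmx_suml; apply: eq_bigr => z _.
  rewrite mulmx_sumr; apply: eq_bigr => z' _.
  by rewrite adjmxZ chi_conj -scalemxAl -scalemxAr scalerA.
rewrite (eq_bigr _ (fun s _ => e s)) exchange_big scaler_sumr; apply: eq_bigr => z _.
rewrite exchange_big (bigD1 z) //= [X in _ + X]big1 => [|z' zz'].
  by rewrite addr0 -scaler_suml chi_orth eqxx mul1r.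
by rewrite -scaler_suml chi_orth eq_sym (negbTE zz') mul0r scale0r.
Qed.

Lemma norm2_gram m k (U : 'M[C]_(m, k)) : norm2 U = \tr (U^t* *m U).
Proof. by rewrite norm2_trace mxtrace_mulC. Qed.

Lemma parseval m k (F : bits n -> 'M[C]_(m, k)) :
  \sum_s norm2 (\sum_z chi z s *: F z) = 2%:R ^+ n * \sum_z norm2 (F z).
Proof.
have := congr1 mxtrace (parseval_gram F).
rewrite mxtraceZ !(raddf_sum (@mxtrace C k)) /= => h.
under eq_bigr do rewrite norm2_gram.
by rewrite h; congr (_ * _); apply: eq_bigr => z _; rewrite norm2_gram.
Qed.

Lemma parseval2 m k (F : bits n -> bits n -> 'M[C]_(m, k)) :
  \sum_s \sum_s' norm2 (\sum_z \sum_z' (chi z s * chi z' s') *: F z z')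
  = 2%:R ^+ n * 2%:R ^+ n * \sum_z \sum_z' norm2 (F z z').
Proof.
rewrite exchange_big (eq_bigr (fun s' => 2%:R ^+ n * \sum_z norm2 (\sum_z' chi z' s' *: F z z'))).
  rewrite -mulr_sumr exchange_big -mulrA; congr (_ * _).
  by rewrite mulr_sumr; apply: eq_bigr => z _; rewrite parseval.
move=> s' _; rewrite -parseval; apply: eq_bigr => s _; congr (norm2 _).
apply: eq_bigr => z _; rewrite scaler_sumr; apply: eq_bigr => z' _.
by rewrite scalerA.
Qed.

(* Summing over the second Bell labels forces [r = r' + a]: two chained Bell pairs contract to one. *)
Lemma bell_contraction m k (F : bits n -> bits n -> 'M[C]_(m, k)) a b r s r' s' :
  \sum_z \sum_z' (chi z s * chi z' s') *:
     ((-1) ^+ (dotb b (bxor r' s') (+) dotb z (bxor (bxor (bxor r s) a) (bxor r' s'))) *: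
        F (bxor (bxor (bxor r s) a) (bxor r' s')) (bxor (bxor z b) z'))
  = ((r == bxor r' a)%:R * 2%:R ^+ n * chi b r') *:
      \sum_z chi z s' *: F (bxor s s') z.
Proof.
set P := bxor (bxor (bxor r s) a) (bxor r' s').
have hP : bxor (bxor s s') P = bxor r (bxor r' a).
  apply/ffunP => i; rewrite !ffunE.
  by case: (s i) (s' i) (r i) (r' i) (a i) => -[] [] [] [].
clearbody P.
transitivity (\sum_z chi z (bxor (bxor s s') P) *: (chi b r' *: \sum_z' chi z' s' *: F P z')).
  (* Translating [z'] by [bxor z b] frees the argument of [F] from [z]; the sum over [z] is then a
     pure character sum. *)
  apply: eq_bigr => z _; rewrite -(reindex_bxor _ (bxor z b)) scalerA scaler_sumr.
  apply: eq_bigr => z' _; rewrite !scalerA signr_addb -/(chi _ _) -/(chi z P).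
  have -> : bxor (bxor z b) (bxor z' (bxor z b)) = z' by rewrite bxorC bxorK.
  congr (_ *: _); rewrite !chi_xorl !chi_xorr.
  have -> : chi z s * (chi z' s' * (chi z s' * chi b s')) * (chi b r' * chi b s' * chi z P)
    = (chi b s') ^+ 2 * (chi z s * chi z s' * chi z P * chi b r' * chi z' s') by ring.
  by rewrite /chi sqrr_sign mul1r.
rewrite -scaler_suml sum_chi hP bxor_eq0 scalerA.
case: eqP => [rr|_]; last by rewrite !mul0r !scale0r.
have -> : P = bxor s s' by apply/eqP; rewrite -bxor_eq0 bxorC hP rr bxor_eq0.
by rewrite mul1r.
Qed.

End Characters.

(** * Bell-basis isometries *)

Section Isometry.
Variables (C : numClosedFieldType) (n : nat).

Definition sq2V : C := (sqrtC 2%:R)^-1.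

Lemma sq2V_sqr : sq2V ^+ 2 = 2%:R^-1.
Proof. by rewrite exprVn sqrtCK. Qed.

Lemma sq2V_ge0 : 0 <= sq2V.
Proof. by rewrite invr_ge0 sqrtC_ge0 ler0n. Qed.

(** This is 2^(-3n/2): 2^(-n) normalises the sum over words and 2^(-n/2) is the amplitude of the EPR
    vector. *)
Definition kappa : C := sq2V ^+ (3 * n).

Lemma kappa_conj : kappa^* = kappa.
Proof. by apply/CrealP/ger0_real; rewrite exprn_ge0 ?sq2V_ge0. Qed.

Lemma two_pow_neq0 : (2%:R : C) ^+ n != 0.
Proof. by rewrite expf_neq0 ?pnatr_eq0. Qed.

Lemma kappa_sqr : kappa ^+ 2 * (2%:R ^+ n * 2%:R ^+ n * 2%:R ^+ n) = 1.
Proof.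
rewrite /kappa -exprM mulnC exprM sq2V_sqr exprM -!exprMn.
rewrite (_ : 2%:R^-1 ^+ 3 * _ = 1) ?expr1n //.
by rewrite !exprS expr0 mulr1 mulrACA -!mulrA mulVKf ?mulVf ?mulr1 ?pnatr_eq0 // mulVf ?pnatr_eq0.
Qed.

Lemma kappa_sqr_two : kappa ^+ 2 * 2%:R ^+ n = sq2V ^+ n * kappa.
Proof.
have e : sq2V ^+ n * sq2V ^+ n * 2%:R ^+ n = 1.
  by rewrite -exprMn -expr2 sq2V_sqr exprVn mulVf ?two_pow_neq0.
rewrite -[RHS]mulr1 -[X in _ = _ * X]e /kappa expr2 mulnC exprM.
by set y := sq2V ^+ n; ring.
Qed.

Variable d : nat.

(* The column space is the qubit register times a Bell partner register times the
   original space; the last two are merged in an ordinal type. *)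
Notation aux_index := ('I_#|{: bits n * 'I_d}|).

(** At the register entry (r, s) only the Bell vectors with x = r + s are nonzero, so the sum over x
    has already collapsed. *)
Definition bell_block (U : bits n -> bits n -> 'M[C]_d) (r s : bits n) : 'M[C]_d :=
  \sum_z chi C z s *: U (bxor r s) z.

Definition bell_iso (U : bits n -> bits n -> 'M[C]_d) :
    (bits n * aux_index)%type -> 'I_d -> C :=
  fun p c => kappa * bell_block U p.1 (enum_val p.2).1 (enum_val p.2).2 c.

Lemma sum_aux_index (F : bits n * 'I_d -> C) :
  \sum_(k : aux_index) F (enum_val k) = \sum_s \sum_i F (s, i).
Proof.
rewrite -(big_enum_val F) pair_bigA /=.
by apply: eq_big => [p|[]].
Qed.

(** Substituting r = x + s separates the labels, Parseval in z leaves U^* U = 1 for each word, and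
    [kappa] squared cancels the resulting factor 2^(3n). *)
Lemma bell_iso_isometry U : (forall x z, U x z \is unitarymx) ->
  forall c c', \sum_p (bell_iso U p c)^* * bell_iso U p c' = (c == c')%:R.
Proof.
move=> uU c c'; rewrite /bell_iso.
pose G r s := (bell_block U r s)^t* *m bell_block U r s.
transitivity (kappa ^+ 2 * (\sum_r \sum_s G r s) c c').
  rewrite (eq_bigr (fun p => kappa ^+ 2 * ((bell_block U p.1 (enum_val p.2).1 (enum_val p.2).2 c)^* * bell_block U p.1 (enum_val p.2).1 (enum_val p.2).2 c'))).
    rewrite -mulr_sumr; congr (_ * _).
    rewrite -(pair_bigA _ (fun r k => (bell_block U r (enum_val k).1 (enum_val k).2 c)^* * bell_block U r (enum_val k).1 (enum_val k).2 c')) /=.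
    rewrite [RHS](@summxE C); apply: eq_bigr => r _; rewrite [RHS](@summxE C).
    rewrite (sum_aux_index (fun q => (bell_block U r q.1 q.2 c)^* * bell_block U r q.1 q.2 c')).
    by apply: eq_bigr => s _; rewrite mxE; apply: eq_bigr => i _; rewrite !mxE.
  by move=> p _; rewrite rmorphM /= kappa_conj; ring.
have -> : \sum_r \sum_s G r s = (2%:R ^+ n * 2%:R ^+ n * 2%:R ^+ n)%:M.
  rewrite exchange_big /=.
  transitivity (\sum_x \sum_s (\sum_z chi C z s *: U x z)^t* *m (\sum_z chi C z s *: U x z)).
    rewrite [RHS]exchange_big; apply: eq_bigr => s _.
    by rewrite -[RHS](reindex_bxor _ s).
  have -> : (2%:R ^+ n * 2%:R ^+ n * 2%:R ^+ n)%:M =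
     \sum_(x : bits n) (2%:R ^+ n *: \sum_(z : bits n) (1%:M : 'M[C]_d)).
    rewrite !sumr_const card_ffun card_bool card_ord -!scaler_nat !natrX !scalerA.
    by rewrite scalemx1; congr (_%:M); ring.
  apply: eq_bigr => x _; rewrite parseval_gram; congr (_ *: _).
  by apply: eq_bigr => z _; rewrite (mulmx1C (unitarymxP (uU x z))).
by rewrite mxE mulrnAr kappa_sqr.
Qed.

End Isometry.

(** * Tensor products and Pauli operators in coordinates *)

Lemma mapp_tens (I1 J1 I2 J2 : finType) (A : mx I1 J1) (B : mx I2 J2) v p :
  mapp (tens A B) v p = \sum_c \sum_c' A p.1 c * B p.2 c' * v (c, c').
Proof.
rewrite pair_bigA /mapp.
by apply: eq_bigr => -[c c'] _.
Qed.

Lemma mapp_tens1 (I1 J1 I2 : finType) (A : mx I1 J1) v p :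
  mapp (tens A (mid I2)) v p = \sum_c A p.1 c * v (c, p.2).
Proof.
rewrite mapp_tens; apply: eq_bigr => c _.
rewrite (big_only1 p.2) // => [|c' cp _]; first by rewrite /mid eqxx mulr1.
by rewrite /mid eq_sym (negbTE cp) mulr0 mul0r.
Qed.

Lemma mmulE (I J K : finType) (A : mx I J) (B : mx J K) i k :
  mmul A B i k = \sum_j A i j * B j k.
Proof. by []. Qed.

Section PauliAction.
Variable n : nat.
Implicit Types x z r c : bits n.

Lemma mprod_sigX x r c : mprod (@sigX n) x r c = (r == bxor c x)%:R.
Proof.
(* Induction on a duplicate-free list of qubits: a repeated index would flip its bit twice. *)
have h (s : seq 'I_n) : uniq s ->
  (\big[@mmul _ _ _/mid _]_(i <- s | x i) sigX i) r c
  = (r == bxor c [ffun i => x i && (i \in s)])%:R.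
  elim: s r => [|i s IH] r /=.
    rewrite big_nil (_ : bxor c _ = c) //.
    by apply/ffunP => i; rewrite !ffunE andbF addbF.
  move=> /andP[si us]; rewrite big_cons; case: ifP => xi; last first.
    rewrite IH // (_ : [ffun j => x j && (j \in i :: s)] = [ffun j => x j && (j \in s)]) //.
    by apply/ffunP => j; rewrite !ffunE inE; case: eqP => // ->; rewrite xi.
  rewrite mmulE.
  set w := bxor c [ffun j => x j && (j \in s)].
  rewrite (eq_bigr (fun y => sigX i r y * (y == w)%:R)) => [|y _]; last by rewrite IH.
  rewrite (big_only1 w) // => [|y /negbTE -> _]; last by rewrite mulr0.
  rewrite eqxx mulr1 /sigX (_ : bxor c _ = [ffun t => if t == i then ~~ w t else w t]) //.
  apply/ffunP => j; rewrite !ffunE inE; case: eqP => [->|] //.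
  by rewrite xi (negbTE si) addbF addbT.
rewrite /mprod h ?index_enum_uniq // (_ : [ffun i => _] = x) //.
by apply/ffunP => i; rewrite ffunE mem_index_enum andbT.
Qed.

Lemma mprod_sigZ z r c : mprod (@sigZ n) z r c = (r == c)%:R * chi CC z c.
Proof.
have h (s : seq 'I_n) :
  (\big[@mmul _ _ _/mid _]_(i <- s | z i) sigZ i) r c
  = (r == c)%:R * (-1) ^+ (\big[addb/false]_(i <- s) (z i && c i)).
  elim: s r => [|i s IH] r; first by rewrite !big_nil mulr1.
  rewrite !big_cons; case: ifP => zi; last by rewrite IH.
  rewrite mmulE.
  rewrite (eq_bigr (fun y => sigZ i r y * ((y == c)%:R *
    (-1) ^+ (\big[addb/false]_(j <- s) (z j && c j))))) => [|y _]; last by rewrite IH.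
  rewrite (big_only1 c) // => [|y /negbTE yc _]; last by rewrite yc mul0r mulr0.
  rewrite eqxx mul1r /sigZ signr_addb mulrA; congr (_ * _ * _).
  by case: (c i).
by rewrite /mprod h.
Qed.

Lemma sgnE b : sgn b = (-1) ^+ b.
Proof. by case: b. Qed.

(** Entries of a Bell vector: the EPR vector is diagonal, so each one is an entry of [sigma] times
    2^(-n/2). *)
Lemma sigma_epr alpha x z r r' :
  mapp (tens (sigma (alpha, x, z)) (mid (bits n))) (epr n) (r, r')
  = (-1) ^+ alpha * ((r == bxor r' x)%:R * chi CC z r' * sq2V CC ^+ n).
Proof.
rewrite mapp_tens1 (big_only1 r') // => [|c /eqP cr _]; last first.
  have [i ci] : exists i, c i != r' i.
    apply/existsP/negP => /existsP h; apply: cr; apply/ffunP => i; apply/eqP/negP => /negP hi.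
    by apply: h; exists i.
  by rewrite /epr (bigD1 i) //= (negbTE ci) !mul0r mulr0.
have -> : epr n (r', r') = sq2V CC ^+ n.
  rewrite /epr (eq_bigr (fun=> sq2V CC)) => [|i _]; last by rewrite eqxx mul1r.
  by rewrite prodr_const card_ord.
rewrite /= sgnE mmulE (big_only1 r') // => [|c cr _]; last first.
  by rewrite mprod_sigZ (negbTE cr) mul0r mulr0.
by rewrite mprod_sigX mprod_sigZ eqxx mul1r -!mulrA.
Qed.

End PauliAction.

(** * The rounding error in the Bell basis *)

Section Rounding.
Variables (C : numClosedFieldType) (n : nat).

Lemma sum_bxor_swap (F : bits n -> bits n -> C) :
  \sum_r \sum_s F (bxor r s) s = \sum_x \sum_s F x s.
Proof.
by rewrite exchange_big [RHS]exchange_big; apply: eq_bigr => s _; rewrite -[RHS](reindex_bxor _ s).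
Qed.

Lemma sum_bits_const (c : C) : \sum_(z : bits n) c = 2%:R ^+ n * c.
Proof. by rewrite sumr_const card_ffun card_bool card_ord -[LHS]mulr_natl natrX. Qed.

(** Parseval on both Bell labels turns the sum into an average over [x], [z], [x'], [z'], so a
    uniform bound survives with constant 1. *)
Lemma sum_bell_blocks m k (D : bits n -> bits n -> bits n -> bits n -> 'M[C]_(m, k)) beta :
  (forall x z x' z', norm2 (D x z x' z') <= beta) ->
  \sum_r \sum_r' \sum_s \sum_s' norm2 (kappa C n ^+ 2 *:
     \sum_z \sum_z' (chi C z s * chi C z' s') *: D (bxor r s) z (bxor r' s') z') <= beta.
Proof.
move=> hD.
pose N x x' s s' := norm2 (\sum_z \sum_z' (chi C z s * chi C z' s') *: D x z x' z').
have -> : \sum_r \sum_r' \sum_s \sum_s' norm2 (kappa C n ^+ 2 *: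
     \sum_z \sum_z' (chi C z s * chi C z' s') *: D (bxor r s) z (bxor r' s') z')
   = kappa C n ^+ 2 * kappa C n ^+ 2 * \sum_x \sum_x' \sum_s \sum_s' N x x' s s'.
  transitivity (kappa C n ^+ 2 * kappa C n ^+ 2 * \sum_r \sum_s \sum_r' \sum_s' N (bxor r s) (bxor r' s') s s').
    rewrite mulr_sumr; apply: eq_bigr => r _; rewrite exchange_big mulr_sumr.
    apply: eq_bigr => s _; rewrite mulr_sumr; apply: eq_bigr => r' _.
    rewrite mulr_sumr; apply: eq_bigr => s' _; rewrite norm2Z normCK rmorphXn.
    by rewrite [X in _ * (X ^+ 2)]kappa_conj.
  congr (_ * _).
  rewrite (sum_bxor_swap (fun x s => \sum_r' \sum_s' N x (bxor r' s') s s')).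
  apply: eq_bigr => x _; rewrite [RHS]exchange_big; apply: eq_bigr => s _.
  exact: (sum_bxor_swap (fun x' s' => N x x' s s')).
have e : \sum_x \sum_x' \sum_s \sum_s' N x x' s s'
   = 2%:R ^+ n * 2%:R ^+ n * \sum_x \sum_x' \sum_z \sum_z' norm2 (D x z x' z').
  rewrite mulr_sumr; apply: eq_bigr => x _; rewrite mulr_sumr; apply: eq_bigr => x' _.
  by rewrite /N parseval2.
have h : \sum_x \sum_x' \sum_z \sum_z' norm2 (D x z x' z')
    <= \sum_(x : bits n) \sum_(x' : bits n) \sum_(z : bits n) \sum_(z' : bits n) beta.
  apply: ler_sum => x _; apply: ler_sum => x' _; apply: ler_sum => z _.
  by apply: ler_sum => z' _.
rewrite e; have k0 : 0 <= kappa C n ^+ 2 * kappa C n ^+ 2 * (2%:R ^+ n * 2%:R ^+ n).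
  by rewrite !mulr_ge0 ?exprn_ge0 ?sq2V_ge0.
rewrite mulrA; apply: (le_trans (ler_wpM2l k0 h)).
have := kappa_sqr C n; rewrite !sum_bits_const.
(* Of the six factors T = 2^n, two come from Parseval and four from the sums over labels; K T^3 = 1
   cancels them all. *)
move: (kappa C n ^+ 2) (2%:R ^+ n) => K T KT.
have -> : K * K * (T * T) * (T * (T * (T * (T * beta)))) = (K * (T * T * T)) ^+ 2 * beta by ring.
by rewrite KT expr1n mul1r.
Qed.

Lemma sum_aux_blocks m k (F : bits n -> bits n -> 'M[C]_(m, k)) :
  (forall x z, norm2 (F x z) = 1) ->
  \sum_s \sum_s' norm2 (kappa C n *: \sum_z chi C z s' *: F (bxor s s') z) = 1.
Proof.
move=> hF.
transitivity (kappa C n ^+ 2 * \sum_s \sum_s' norm2 (\sum_z chi C z s' *: F (bxor s s') z)).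
  rewrite mulr_sumr; apply: eq_bigr => s _; rewrite mulr_sumr; apply: eq_bigr => s' _.
  by rewrite norm2Z normCK kappa_conj expr2.
rewrite (sum_bxor_swap (fun x s' => norm2 (\sum_z chi C z s' *: F x z))).
rewrite -(kappa_sqr C n); congr (_ * _).
transitivity (\sum_(x : bits n) 2%:R ^+ n * \sum_(z : bits n) (1 : C)).
  by apply: eq_bigr => x _; rewrite parseval; congr (_ * _); apply: eq_bigr.
by rewrite !sum_bits_const mulr1 !mulrA.
Qed.

Variables (dA dB : nat) (UA : bits n -> bits n -> 'M[C]_dA) (UB : bits n -> bits n -> 'M[C]_dB).
Variable Psi : 'M[C]_(dA, dB).

Definition defect a b x z x' z' : 'M[C]_(dA, dB) :=
  (UA x z)^t* *m (UA a b *m (Psi *m UB x' z')) -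
  (-1) ^+ (dotb b x' (+) dotb z (bxor (bxor x a) x')) *:
    (UA (bxor (bxor x a) x') (bxor (bxor z b) z') *m Psi).

(** [bell_contraction] writes the ideal vector as a double Bell sum of the same shape as the actual
    one, so the two subtract term by term. *)
Lemma bell_block_defect (alpha : bool) a b r s r' s' :
  kappa C n ^+ 2 *: (bell_block (fun x z => (UA x z)^t*) r s *m ((-1) ^+ alpha *: (UA a b *m Psi))
       *m (bell_block (fun x z => (UB x z)^T) r' s')^T)
  - ((-1) ^+ alpha * ((r == bxor r' a)%:R * chi C b r' * sq2V C ^+ n)) *:
       (kappa C n *: \sum_z chi C z s' *: (UA (bxor s s') z *m Psi))
  = (-1) ^+ alpha *: (kappa C n ^+ 2 *:
       \sum_z \sum_z' (chi C z s * chi C z' s') *: defect a b (bxor r s) z (bxor r' s') z').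
Proof.
have -> : \sum_z \sum_z' (chi C z s * chi C z' s') *: defect a b (bxor r s) z (bxor r' s') z'
  = bell_block (fun x z => (UA x z)^t*) r s *m (UA a b *m Psi)
       *m (bell_block (fun x z => (UB x z)^T) r' s')^T -
    ((r == bxor r' a)%:R * 2%:R ^+ n * chi C b r') *:
      \sum_z chi C z s' *: (UA (bxor s s') z *m Psi).
  rewrite -(bell_contraction (fun x z => UA x z *m Psi)).
  have -> : (bell_block (fun x z => (UB x z)^T) r' s')^T
     = \sum_z' chi C z' s' *: UB (bxor r' s') z'.
    rewrite /bell_block raddf_sum; apply: eq_bigr => z' _.
    by rewrite /= linearZ /= trmxK.
  rewrite -mulmxA /bell_block mulmx_suml -sumrB; apply: eq_bigr => z _.
  rewrite !mulmx_sumr -sumrB; apply: eq_bigr => z' _.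
  by rewrite -!(scalemxAl, scalemxAr) scalerA -scalerBr /defect !mulmxA.
rewrite scalerBr -scalemxAr -scalemxAl [in RHS]scalerBr !scalerA; congr (_ *: _ - _ *: _).
  by rewrite mulrC.
(* The scalar kappa^2 2^n splits into the EPR amplitude 2^(-n/2) and the normalisation [kappa] of
   the auxiliary state. *)
set d := _%:R; transitivity ((-1) ^+ alpha * d * chi C b r' * (sq2V C ^+ n * kappa C n)).
  by ring.
by rewrite -kappa_sqr_two; ring.
Qed.

End Rounding.

Section RegisterSums.
Variables (C : numClosedFieldType) (n dA dB : nat).

Lemma sum_aux_pair (F : bits n * 'I_dA -> bits n * 'I_dB -> C) :
  \sum_(p : 'I_#|{: bits n * 'I_dA}| * 'I_#|{: bits n * 'I_dB}|) F (enum_val p.1) (enum_val p.2)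
  = \sum_s \sum_s' \sum_i \sum_i' F (s, i) (s', i').
Proof.
rewrite -(pair_bigA _ (fun k l => F (enum_val k) (enum_val l))) /=.
rewrite (sum_aux_index (fun q => \sum_l F q (enum_val l))).
apply: eq_bigr => s _; rewrite [RHS]exchange_big; apply: eq_bigr => i _.
by rewrite (sum_aux_index (F (s, i))).
Qed.

Lemma sum_registers (F : bits n -> bits n -> bits n * 'I_dA -> bits n * 'I_dB -> C) :
  \sum_(p : (bits n * bits n) * ('I_#|{: bits n * 'I_dA}| * 'I_#|{: bits n * 'I_dB}|))
     F p.1.1 p.1.2 (enum_val p.2.1) (enum_val p.2.2)
  = \sum_r \sum_r' \sum_s \sum_s' \sum_i \sum_i' F r r' (s, i) (s', i').
Proof.
rewrite -(pair_bigA _ (fun q k => F q.1 q.2 (enum_val k.1) (enum_val k.2))) /=.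
rewrite -(pair_bigA _ (fun r r' => \sum_k F r r' (enum_val k.1) (enum_val k.2))) /=.
by apply: eq_bigr => r _; apply: eq_bigr => r' _; rewrite sum_aux_pair.
Qed.

Lemma sandwich_entry (k : C) m m' (G : 'M[C]_(m, dA)) (H : 'M[C]_(m', dB)) (W : 'M[C]_(dA, dB)) i i' :
  \sum_c \sum_c' k * G i c * (k * H i' c') * W c c' = (k ^+ 2 *: (G *m W *m H^T)) i i'.
Proof.
rewrite !mxE mulr_sumr exchange_big; apply: eq_bigr => c' _.
rewrite !mxE mulr_suml mulr_sumr; apply: eq_bigr => c _; ring.
Qed.

Lemma sub_scale_entry (k : C) m m' (U V : 'M[C]_(m, m')) i j :
  (U - k *: V) i j = U i j - k * V i j.
Proof. by rewrite !mxE. Qed.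

Lemma scale_mul_entry (k : C) m m' l (U : 'M[C]_(m, l)) (V : 'M[C]_(l, m')) i j :
  (k *: (U *m V)) i j = \sum_c k * U i c * V c j.
Proof. by rewrite !mxE mulr_sumr; apply: eq_bigr => c _; rewrite mulrA. Qed.

End RegisterSums.

Definition state_mx dA dB (v : vec ('I_dA * 'I_dB)%type) : 'M[CC]_(dA, dB) :=
  \matrix_(i, j) v (i, j).

Lemma norm2_state_mx dA dB (v : vec ('I_dA * 'I_dB)%type) : norm2 (state_mx v) = vnorm2 v.
Proof.
by rewrite /norm2 pair_bigA; apply: eq_bigr => -[i j] _; rewrite mxE.
Qed.

(* Gowers-Hatami rounding, carried out for both players at once. *)
Lemma epr_rounding n dA dB (UA : bits n -> bits n -> 'M[CC]_dA)
    (UB : bits n -> bits n -> 'M[CC]_dB) (v : vec ('I_dA * 'I_dB)%type) (beta : CC) :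
  (forall x z, UA x z \is unitarymx) -> (forall x z, UB x z \is unitarymx) ->
  vnorm2 v = 1 ->
  (forall a b x z x' z', norm2 (defect UA UB (state_mx v) a b x z x' z') <= beta) ->
  exists (eA eB : nat) (VA : mx (bits n * 'I_eA)%type 'I_dA)
         (VB : mx (bits n * 'I_eB)%type 'I_dB) (aux : vec ('I_eA * 'I_eB)%type),
  [/\ is_isometry VA, is_isometry VB, vnorm2 aux = 1 &
   forall (alpha : bool) a b (F : mx 'I_dA 'I_dA),
     (forall i j, F i j = (-1) ^+ alpha * UA a b i j) ->
     vnorm2 (fun p : ((bits n * bits n) * ('I_eA * 'I_eB))%type =>
          mapp (tens VA VB) (mapp (tens F (mid 'I_dB)) v)
               ((p.1.1, p.2.1), (p.1.2, p.2.2))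
          - mapp (tens (sigma (alpha, a, b)) (mid (bits n))) (epr n) p.1 * aux p.2) <= beta].
Proof.
move=> uA uB v1 hbeta; set Psi := state_mx v in hbeta *.
(* Alice's isometry carries adjoints. Bob's carries transposes, which become [UB] itself when acting
   on [Psi] from the right. *)
pose VA : mx _ _ := bell_iso (fun x z => (UA x z)^t*).
pose VB : mx _ _ := bell_iso (fun x z => (UB x z)^T).
(* The factor left after contraction: 2^(-n) times the sum over x, z of the Bell vector of (x, z)
   tensored with UA(x, z) Psi. *)
pose aux_block s s' := kappa CC n *: \sum_z chi CC z s' *: (UA (bxor s s') z *m Psi).
pose aux : vec ('I_#|{: bits n * 'I_dA}| * 'I_#|{: bits n * 'I_dB}|)%type := fun p =>
  aux_block (enum_val p.1).1 (enum_val p.2).1 (enum_val p.1).2 (enum_val p.2).2.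
exists #|{: bits n * 'I_dA}|, #|{: bits n * 'I_dB}|, VA, VB, aux; split.
- by apply: bell_iso_isometry => x z; rewrite trmxC_unitary.
- by apply: bell_iso_isometry => x z; rewrite trmx_unitary.
- rewrite /vnorm2 (sum_aux_pair (fun q q' => `|aux_block q.1 q'.1 q.2 q'.2| ^+ 2)).
  apply: (sum_aux_blocks (F := fun x z => UA x z *m Psi)) => x z.
  by rewrite norm2_unitaryl // norm2_state_mx.
move=> alpha a b F hF.
pose Err r r' s s' : 'M[CC]_(dA, dB) := (-1) ^+ alpha *: (kappa CC n ^+ 2 *:
       \sum_z \sum_z' (chi CC z s * chi CC z' s') *: defect UA UB Psi a b (bxor r s) z (bxor r' s') z').
have errE p : mapp (tens VA VB) (mapp (tens F (mid 'I_dB)) v) ((p.1.1, p.2.1), (p.1.2, p.2.2))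
          - mapp (tens (sigma (alpha, a, b)) (mid (bits n))) (epr n) p.1 * aux p.2
   = Err p.1.1 p.1.2 (enum_val p.2.1).1 (enum_val p.2.2).1 (enum_val p.2.1).2 (enum_val p.2.2).2.
  case: p => -[r r'] [k k'] /=; rewrite /Err -bell_block_defect sigma_epr.
  rewrite [RHS](@sub_scale_entry CC) -(@sandwich_entry CC) mapp_tens.
  apply: (f_equal2 (fun t u : CC => t - u)) => //.
  apply: eq_bigr => c _; apply: eq_bigr => c' _; apply: (f_equal2 (fun t u : CC => t * u)) => //.
  rewrite mapp_tens1 (@scale_mul_entry CC); apply: eq_bigr => j _.
  by rewrite /= hF /Psi mxE.
rewrite /vnorm2 (eq_bigr _ (fun p _ => congr1 (fun c => `|c| ^+ 2) (errE p))).
rewrite (sum_registers (fun r r' q q' => `|Err r r' q.1 q'.1 q.2 q'.2| ^+ 2)).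
have := sum_bell_blocks (fun x z x' z' => hbeta a b x z x' z').
congr (_ <= _); apply: eq_bigr => r _; apply: eq_bigr => r' _.
apply: eq_bigr => s _; apply: eq_bigr => s' _.
by rewrite -[RHS]/(norm2 (Err r r' s s')) [RHS]norm2Z normrX normrN1 !expr1n mul1r.
Qed.

(** * Projective measurements and observables *)

Section Measurements.
Variable C : numClosedFieldType.

Lemma adjmxM m n p (U : 'M[C]_(m, n)) (V : 'M[C]_(n, p)) : (U *m V)^t* = V^t* *m U^t*.
Proof. by rewrite trmx_mul map_mxM. Qed.

Lemma norm2_eq0 m n (U : 'M[C]_(m, n)) : norm2 U = 0 -> U = 0.
Proof. by move=> U0; apply: (@close0_eq _ 0); rewrite /close subr0 U0 mul0r. Qed.

Definition pvm_mx (O : finType) d (F : O -> 'M[C]_d) : Prop :=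
  [/\ forall o, (F o)^t* = F o, forall o, F o *m F o = F o & \sum_o F o = 1%:M].

Section Observables.
Variables (O : finType) (d : nat) (F : O -> 'M[C]_d).
Hypothesis pvmF : pvm_mx F.

(** The other projections add up to 1 - F_o, so the squared norms of their products with F_o add up
    to tr (F_o (1 - F_o) F_o) = 0. *)
Lemma pvm_orth o o' : o != o' -> F o' *m F o = 0.
Proof.
have [hF iF sF] := pvmF => noo.
have nE p : norm2 (F p *m F o) = \tr (F o *m F p *m F o).
  by rewrite norm2_gram adjmxM !hF !mulmxA -(mulmxA (F o) (F p) (F p)) iF.
have : \sum_(p | p != o) norm2 (F p *m F o) = 0.
  rewrite (eq_bigr _ (fun p _ => nE p)) -(raddf_sum (@mxtrace C d)) -mulmx_suml -mulmx_sumr.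
  have -> : \sum_(p | p != o) F p = 1%:M - F o by apply/eqP; rewrite eq_sym subr_eq -sF [eqbLHS](bigD1 o) //= addrC.
  by rewrite mulmxBr mulmx1 iF subrr mul0mx raddf0.
move/eqP; rewrite psumr_eq0 => [/allP/(_ o' (mem_index_enum _))|p _]; last exact: norm2_ge0.
by rewrite eq_sym noo => /eqP /norm2_eq0.
Qed.

(** Observables read off one measurement multiply exactly, by adding their sign functions, and hence
    commute. *)
Definition obs (f : O -> bool) : 'M[C]_d := \sum_o (-1) ^+ f o *: F o.

Lemma obs_mul f g : obs f *m obs g = obs (fun o => f o (+) g o).
Proof.
have [_ iF _] := pvmF.
rewrite /obs mulmx_suml; apply: eq_bigr => o _.
rewrite mulmx_sumr (bigD1 o) //= big1 => [|p po].
  by rewrite addr0 -scalemxAl -scalemxAr iF scalerA signr_addb.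
by rewrite -scalemxAl -scalemxAr pvm_orth // !scaler0.
Qed.

Lemma eq_obs f g : f =1 g -> obs f = obs g.
Proof. by move=> fg; apply: eq_bigr => o _; rewrite fg. Qed.

Lemma obs_addb f b : obs (fun o => b (+) f o) = (-1) ^+ b *: obs f.
Proof. by rewrite /obs scaler_sumr; apply: eq_bigr => o _; rewrite scalerA signr_addb. Qed.

Lemma obs_herm f : (obs f)^t* = obs f.
Proof.
have [hF _ _] := pvmF.
by rewrite adjmx_sum; apply: eq_bigr => o _; rewrite adjmxZ hF rmorph_sign.
Qed.

Lemma obs_sqr f : obs f *m obs f = 1%:M.
Proof.
have [_ _ <-] := pvmF.
by rewrite obs_mul; apply: eq_bigr => o _; rewrite addbb scale1r.
Qed.

Lemma obs_unitary f : obs f \is unitarymx.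
Proof. by apply/unitarymxP; rewrite obs_herm obs_sqr. Qed.

End Observables.

Variables (dA dB : nat) (Psi : 'M[C]_(dA, dB)).

(** With [G] the transpose of Bob's operator, this is the probability of a pair of outcomes. *)
Definition joint (E : 'M[C]_dA) (G : 'M[C]_dB) : C := \tr (Psi^t* *m (E *m Psi *m G)).

Lemma joint_ge0 E G : E^t* = E -> E *m E = E -> G^t* = G -> G *m G = G -> 0 <= joint E G.
Proof.
move=> hE iE hG iG.
suff -> : joint E G = norm2 (E *m Psi *m G) by exact: norm2_ge0.
rewrite norm2_gram !adjmxM hE hG !mulmxA -(mulmxA _ E E) iE.
rewrite -[in RHS](mulmxA G) -[in RHS](mulmxA G) -[in RHS](mulmxA G) mxtrace_mulC.
by rewrite /joint !mulmxA -(mulmxA _ G G) iG.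
Qed.

Variables (O : finType) (E : bool -> 'M[C]_dA) (F : O -> 'M[C]_dB).
Hypotheses (pvmE : pvm_mx E) (pvmF : pvm_mx F).

Definition agree (f : O -> bool) : C := \sum_o joint (E (f o)) (F o).

Lemma joint_pvm_ge0 c o : 0 <= joint (E c) (F o).
Proof. by have [? ? _] := pvmE; have [? ? _] := pvmF; apply: joint_ge0. Qed.

Lemma joint_comb (a : bool -> C) (b : O -> C) :
  joint (\sum_c a c *: E c) (\sum_o b o *: F o)
  = \sum_o \sum_c (a c * b o) * joint (E c) (F o).
Proof.
rewrite /joint !mulmx_sumr (raddf_sum (@mxtrace C dB)); apply: eq_bigr => o _.
rewrite !mulmx_suml mulmx_sumr (raddf_sum (@mxtrace C dB)); apply: eq_bigr => c _.
by rewrite /= -!(scalemxAl, scalemxAr) scalerA mxtraceZ ?(mulrC (b o)).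
Qed.

Lemma sum_joint : \sum_o \sum_c joint (E c) (F o) = norm2 Psi.
Proof.
have [_ _ sE] := pvmE; have [_ _ sF] := pvmF.
have := joint_comb (fun=> 1) (fun=> 1).
under eq_bigr do rewrite scale1r.
under [\sum_(o : O) _ *: _]eq_bigr do rewrite scale1r.
rewrite sE sF /joint mul1mx mulmx1 -norm2_gram => ->.
by apply: eq_bigr => o _; apply: eq_bigr => c _; rewrite !mul1r.
Qed.

(** Both observables square to 1, so the left side is 2 (N - c) with N = [norm2 Psi] and c the
    correlation; moreover c = 2 [agree f] - N. *)
Lemma norm2_disagree f :
  norm2 (obs E id *m Psi - Psi *m obs F f) = 4%:R * (norm2 Psi - agree f).
Proof.
have [_ _ sE] := pvmE; have [_ _ sF] := pvmF.
set T := obs E id; set N := obs F f.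
have hT : T^t* = T by exact: obs_herm.
have hN : N^t* = N by exact: obs_herm.
have adjB m n (U V : 'M[C]_(m, n)) : (U - V)^t* = U^t* - V^t*.
  by apply/matrixP => i j; rewrite !mxE rmorphB.
have -> : norm2 (T *m Psi - Psi *m N) = 2%:R * (norm2 Psi - \tr (Psi^t* *m (T *m Psi *m N))).
  rewrite !norm2_gram adjB !adjmxM hT hN mulmxBl !mulmxBr !raddfB /=.
  have -> : \tr (Psi^t* *m T *m (T *m Psi)) = \tr (Psi^t* *m Psi).
    by rewrite !mulmxA -(mulmxA _ T T) obs_sqr // mulmx1.
  have -> : \tr (N *m Psi^t* *m (Psi *m N)) = \tr (Psi^t* *m Psi).
    by rewrite -mulmxA mxtrace_mulC -!mulmxA obs_sqr // mulmx1.
  have -> : \tr (N *m Psi^t* *m (T *m Psi)) = \tr (Psi^t* *m (T *m Psi *m N)).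
    by rewrite -mulmxA mxtrace_mulC !mulmxA.
  rewrite !mulmxA; ring.
have -> : \tr (Psi^t* *m (T *m Psi *m N)) = joint T N by [].
rewrite joint_comb -sum_joint /agree -!sumrB !mulr_sumr; apply: eq_bigr => o _.
by rewrite !big_bool /=; case: (f o); rewrite !expr1 ?expr0; ring.
Qed.

(** Outcomes outside [P] can only add agreement, so any extension [f] of [s] from [P] obeys the
    bound. *)
Lemma norm2_disagree_le (P : pred O) (s f : O -> bool) :
  (forall o, P o -> f o = s o) ->
  norm2 (obs E id *m Psi - Psi *m obs F f)
  <= 4%:R * (norm2 Psi - \sum_(o | P o) joint (E (s o)) (F o)).
Proof.
move=> fs; rewrite norm2_disagree; apply: ler_wpM2l => //.
rewrite lerD2l lerN2 (eq_bigr (fun o => joint (E (f o)) (F o))) => [|o /fs -> //].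
rewrite /agree [leRHS](bigID P) /= lerDl.
by apply: sumr_ge0 => o _; exact: joint_pvm_ge0.
Qed.

Lemma sum_joint_le (P : pred O) (s : O -> bool) :
  \sum_(o | P o) joint (E (s o)) (F o) <= norm2 Psi.
Proof.
rewrite -subr_ge0 -(pmulr_rge0 _ (ltr0Sn C 3)).
by apply: le_trans (norm2_ge0 _) (norm2_disagree_le (fun o _ => erefl (s o))).
Qed.

End Measurements.

(** * The magic square *)

Section MagicSquare.
Variables (C : numClosedFieldType) (D : C) (dA dB : nat).
Variables (T : msvar -> 'M[C]_dA) (Psi : 'M[C]_(dA, dB)).
Variables (F : msline -> {ffun 'I_3 -> bool} -> 'M[C]_dB).
Hypothesis uT : forall v, T v \is unitarymx.
Hypothesis pvmF : forall q, pvm_mx (F q).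

(* Reading the last value off the first two makes the parity constraint hold exactly, also on
   unsatisfying assignments. *)
Definition line_value (q : msline) (t : 'I_3) (s : {ffun 'I_3 -> bool}) : bool :=
  if t == 0 then s 0 else if t == 1 then s 1 else line_parity q (+) (s 0 (+) s 1).

Lemma line_value_sat q t s : sat q s -> line_value q t s = s t.
Proof.
rewrite /sat /line_value !big_ord_recl big_ord0 addn0 => /eqP <-.
have -> : lift ord0 (lift ord0 ord0) = 2 :> 'I_3 by apply: val_inj.
have -> : lift ord0 ord0 = 1 :> 'I_3 by apply: val_inj.
rewrite -[ord0]/(0 : 'I_3); have [->|t0] := eqVneq t 0 => //.
have [->|t1] := eqVneq t 1 => //.
have -> : t = 2 by case: t t0 t1 => -[|[|[|?]]] // i _ _; apply: val_inj.
by rewrite !oddD; case: (s 0) (s 1) (s 2) => -[] [].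
Qed.

Lemma line_value_sum q (t1 t2 t3 : 'I_3) s : t1 != t2 -> t1 != t3 -> t2 != t3 ->
  line_value q t1 s (+) line_value q t2 s = line_parity q (+) line_value q t3 s.
Proof.
rewrite /line_value.
case: t1 t2 t3 => -[|[|[|?]]] // i1 [] -[|[|[|?]]] // i2 [] -[|[|[|?]]] // i3;
  by rewrite -?val_eqE //=; case: (line_parity q) (s 0) (s 1) => -[] [].
Qed.

Hypothesis consistent : forall q t,
  close D 1 (T (var_of q t) *m Psi) (Psi *m obs (F q) (line_value q t)).

(** Both letters are carried to one measurement of Bob, multiplied there exactly, and the product is
    carried back: three uses of consistency. *)
Lemma line_relation q t1 t2 t3 : t1 != t2 -> t1 != t3 -> t2 != t3 ->
  close D 3 (T (var_of q t1) *m (T (var_of q t2) *m Psi))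
    ((-1) ^+ line_parity q *: (T (var_of q t3) *m Psi)).
Proof.
move=> h12 h13 h23.
have h := close_mull (uT (var_of q t1)) (consistent q t2).
apply: (close_trans (k := 1) (l := 2) h); rewrite mulmxA.
apply: (close_trans (k := 1) (l := 1) (close_mulr (obs_unitary (pvmF q) _) (consistent q t1))).
rewrite -mulmxA obs_mul // (eq_obs _ (fun s => line_value_sum q s h12 h13 h23)) obs_addb.
by rewrite -scalemxAr; apply: close_sign; exact: close_sym.
Qed.

(* [T u T v] is rewritten as [T u T w T k] and then as [T l T k]; [T k] waits on the right of [Psi]. *)
Lemma product_exchange u q t (b b' : bool) v w l :
  close D 3 (T w *m (T (var_of q t) *m Psi)) ((-1) ^+ b *: (T v *m Psi)) ->
  close D 3 (T u *m (T w *m Psi)) ((-1) ^+ b' *: (T l *m Psi)) ->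
  close D 8 (T u *m (T v *m Psi)) ((-1) ^+ (b (+) b') *: (T l *m (T (var_of q t) *m Psi))).
Proof.
move=> hv hl; have uN := obs_unitary (pvmF q) (line_value q t).
have {}hv := close_sign b (close_sym hv).
rewrite scalerA -signr_addb addbb expr0 scale1r in hv.
apply: (close_trans (k := 3) (l := 5) (close_mull (uT u) hv)).
rewrite signr_addb -scalerA -scalemxAr; apply: close_sign.
have hk := consistent q t.
apply: (close_trans (k := 1) (l := 4) (close_mull (uT u) (close_mull (uT w) hk))).
apply: (@close_trans _ _ 3 1 _ _ ((-1) ^+ b' *: (T l *m (Psi *m obs (F q) (line_value q t))))).
  by rewrite !mulmxA scalemxAl; apply: close_mulr => //; rewrite -mulmxA.
by apply: close_sign; apply: close_mull => //; exact: close_sym.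
Qed.

(** The first pair of cells is Z and X on the first qubit, the second pair the same on the second
    qubit. Each chain has three exchanges of cost 8, and its only minus sign is the odd parity of
    the third column. *)
Lemma magic_square_swap :
  close D 24 (T (0, 1) *m (T (1, 0) *m Psi)) (- (T (1, 0) *m (T (0, 1) *m Psi))) /\
  close D 24 (T (0, 0) *m (T (1, 1) *m Psi)) (- (T (1, 1) *m (T (0, 0) *m Psi))).
Proof.
have row (r a b c : 'I_3) : a != b -> a != c -> b != c ->
   close D 3 (T (r, a) *m (T (r, b) *m Psi)) ((-1) ^+ false *: (T (r, c) *m Psi)).
  exact: (line_relation (false, r)).
have col (c : 'I_3) i j k : i != j -> i != k -> j != k ->
   close D 3 (T (i, c) *m (T (j, c) *m Psi)) ((-1) ^+ (nat_of_ord c == 2)%N *: (T (k, c) *m Psi)).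
  exact: (line_relation (true, c)).
have exrow u (r k : 'I_3) := @product_exchange u (false, r) k.
have excol u (c k : 'I_3) := @product_exchange u (true, c) k.
split.
(* On [Psi] the chain is T(0,1) T(1,0) ~ T(2,1) T(1,2) ~ - T(2,0) T(0,2) ~ - T(1,0) T(0,1). *)
- have h1 := exrow (0, 1) 1 2 _ _ _ _ _ (row 1 1 2 0 isT isT isT) (col 1 0 1 2 isT isT isT).
  have h2 := exrow (1, 0) 0 2 _ _ _ _ _ (row 0 0 2 1 isT isT isT) (col 0 1 0 2 isT isT isT).
  have h3 := excol (2, 1) 2 0 _ _ _ _ _ (col 2 2 0 1 isT isT isT) (row 2 1 2 0 isT isT isT).
  rewrite /= ?expr0 ?scale1r in h1 h2 h3.
  apply: (close_trans (k := 8) (l := 16) h1).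
  apply: (close_trans (k := 8) (l := 8) h3); rewrite expr1 !scaleN1r -!scaleN1r.
  by rewrite -[-1](expr1 (-1)); apply: (close_sign true); exact: close_sym.
(* The same chain with the first two columns interchanged. *)
have h1 := exrow (0, 0) 1 2 _ _ _ _ _ (row 1 0 2 1 isT isT isT) (col 0 0 1 2 isT isT isT).
have h2 := exrow (1, 1) 0 2 _ _ _ _ _ (row 0 1 2 0 isT isT isT) (col 1 1 0 2 isT isT isT).
have h3 := excol (2, 0) 2 0 _ _ _ _ _ (col 2 2 0 1 isT isT isT) (row 2 0 2 1 isT isT isT).
rewrite /= ?expr0 ?scale1r in h1 h2 h3.
apply: (close_trans (k := 8) (l := 16) h1).
apply: (close_trans (k := 8) (l := 8) h3); rewrite expr1 !scaleN1r -!scaleN1r.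
by rewrite -[-1](expr1 (-1)); apply: (close_sign true); exact: close_sym.
Qed.

End MagicSquare.

(** * Averages *)

Section Averages.
Variable C : numClosedFieldType.

Section Over.
Variables (T : finType) (A : {set T}) (f : T -> C).
Hypothesis f_le1 : forall x, x \in A -> f x <= 1.

Lemma card_avg_loss : A != set0 ->
  #|A|%:R * (1 - (#|A|%:R)^-1 * \sum_(x in A) f x) = \sum_(x in A) (1 - f x).
Proof.
rewrite -card_gt0 => A0; rewrite mulrBr mulr1 mulrA divff ?mul1r ?pnatr_eq0 -?lt0n //.
by rewrite sumrB sumr_const.
Qed.

(** Losses are nonnegative, so one question loses at most the total, which is the number of
    questions times the average loss. *)
Lemma avgS_loss x0 : x0 \in A ->
  1 - f x0 <= #|A|%:R * (1 - (#|A|%:R)^-1 * \sum_(x in A) f x).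
Proof.
move=> Ax0; rewrite card_avg_loss; last by apply/set0Pn; exists x0.
rewrite (bigD1 x0) //= lerDl sumr_ge0 // => x /andP[Ax _].
by rewrite subr_ge0 f_le1.
Qed.

Lemma avgS_le1 : (#|A|%:R)^-1 * \sum_(x in A) f x <= 1.
Proof.
have [->|A0] := eqVneq A set0; first by rewrite big_set0 mulr0 ler01.
rewrite -subr_ge0 -(pmulr_rge0 _ (x := #|A|%:R)) ?ltr0n ?card_gt0 //.
rewrite card_avg_loss // sumr_ge0 // => x Ax.
by rewrite subr_ge0 f_le1.
Qed.

End Over.

Lemma avgT_loss (T : finType) (f : T -> C) x0 : (forall x, f x <= 1) ->
  1 - f x0 <= #|T|%:R * (1 - (#|T|%:R)^-1 * \sum_x f x).
Proof.
move=> f1; have := @avgS_loss T setT f (fun x _ => f1 x) x0 (in_setT _).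
by rewrite cardsT (eq_bigl predT) // => x; rewrite in_setT.
Qed.

Lemma avgT_le1 (T : finType) (f : T -> C) : (forall x, f x <= 1) ->
  (#|T|%:R)^-1 * \sum_x f x <= 1.
Proof.
move=> f1; have := @avgS_le1 T setT f (fun x _ => f1 x).
by rewrite cardsT (eq_bigl predT) // => x; rewrite in_setT.
Qed.

Definition ebit n (i : 'I_n) : bits n := [ffun t => t == i].

(* A function of two coordinates of [W] takes each of its values on at least a quarter of all [W]. *)
Lemma avgT_local_loss n (f g : bits n -> C) (K : C) (i j : 'I_n) (W0 : bits n) :
  (forall W, f W <= 1) ->
  (forall W W' : bits n, W i = W' i -> W j = W' j -> f W = f W') ->
  (forall W, 1 - f W <= K * (1 - g W)) ->
  1 - f W0 <= 4%:R * K * (1 - (#|{: bits n}|%:R)^-1 * \sum_W g W).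
Proof.
move=> f1 floc fg.
have cb : 0 < #|{: bits n}|%:R :> C.
  by rewrite ltr0n; apply/card_gt0P; exists W0.
rewrite -(ler_pM2l cb).
(* Toggles the coordinates [i] and [j]; one of the four results agrees with [W0] at both. *)
pose flip (b c : bool) (W : bits n) : bits n :=
  bxor (bxor W (if b then ebit i else bzero n)) (if c then ebit j else bzero n).
have h (W : bits n) : 1 - f W0 <= \sum_(b : bool) \sum_(c : bool) (1 - f (flip b c W)).
  (* If [i = j] the second toggle would undo the first, so it is switched off. *)
  pose b := W i (+) W0 i; pose c := (j != i) && (W j (+) W0 j).
  have -> : f W0 = f (flip b c W).
    apply: floc; rewrite /flip /b /c; case: (eqVneq j i) => [->|ji] /=.
    - by rewrite !ffunE; case: (W i) (W0 i) => -[]; rewrite ?ffunE ?eqxx.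
    - rewrite !ffunE; case: (W j) (W0 j) => -[]; case: (W i) (W0 i) => -[];
      by rewrite /= ?ffunE ?eqxx // ?(eq_sym i) (negbTE ji).
    - by rewrite !ffunE; case: (W i) (W0 i) => -[]; rewrite ?ffunE ?eqxx.
    rewrite !ffunE; case: (W j) (W0 j) => -[]; case: (W i) (W0 i) => -[];
      by rewrite /= ?ffunE ?eqxx // (negbTE ji).
  rewrite (bigD1 b) //= (bigD1 c) //= -addrA lerDl.
  by rewrite addr_ge0 ?sumr_ge0 // => *; rewrite ?sumr_ge0 // => *; rewrite subr_ge0.
have -> : #|{: bits n}|%:R * (1 - f W0) = \sum_(W : bits n) (1 - f W0).
  by rewrite sumr_const mulr_natl.
apply: (@le_trans _ _ (4%:R * \sum_W (1 - f W))).
  apply: le_trans (ler_sum _ (fun W _ => h W)) _.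
  rewrite exchange_big /=.
  have e b c : \sum_W (1 - f (flip b c W)) = \sum_W (1 - f W).
    rewrite /flip (reindex_bxor _ _ (fun W => 1 - f (bxor W _))).
    by rewrite (reindex_bxor _ _ (fun W => 1 - f W)).
  rewrite le_eqVlt; apply/orP; left; apply/eqP.
  rewrite (eq_bigr (fun=> 2%:R * \sum_W (1 - f W))) => [|b _]; last first.
    by rewrite exchange_big big_bool /= !e; ring.
  by rewrite big_bool /=; ring.
have -> : #|{: bits n}|%:R * (4%:R * K * (1 - (#|{: bits n}|%:R)^-1 * \sum_W g W))
  = 4%:R * \sum_W K * (1 - g W).
  rewrite -mulr_sumr sumrB sumr_const; field.
  by rewrite gt_eqF.
by rewrite ler_pM2l ?ltr0n //; apply: ler_sum => W _.
Qed.

(** Alice is asked one of three or one of two questions; the factor 3 covers both cases. *)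
Lemma three_loss (b : bool) (p1 p2 p3 : C) : p1 <= 1 -> p2 <= 1 -> p3 <= 1 ->
  let p := if b then (p1 + p2 + p3) / 3%:R else (p1 + p2) / 2%:R in
  [/\ p <= 1, 1 - p1 <= 3%:R * (1 - p) & 1 - p2 <= 3%:R * (1 - p)].
Proof.
rewrite -(subr_ge0 p1) -(subr_ge0 p2) -(subr_ge0 p3) => h1 h2 h3 /=.
case: b.
  have e : 3%:R * (1 - (p1 + p2 + p3) / 3%:R) = (1 - p1) + (1 - p2) + (1 - p3) by field.
  rewrite -subr_ge0 -(pmulr_rge0 _ (ltr0Sn C 2)) e.
  move: (1 - p1) (1 - p2) (1 - p3) h1 h2 h3 {e} => x1 x2 x3 h1 h2 h3; split.
  - by rewrite !addr_ge0.
  - by rewrite -addrA lerDl addr_ge0.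
  by rewrite [x1 + x2]addrC -addrA lerDl addr_ge0.
have e : 2%:R * (1 - (p1 + p2) / 2%:R) = (1 - p1) + (1 - p2) by field.
have e3 : 3%:R * (1 - (p1 + p2) / 2%:R) = (1 - p1) + (1 - p2) + ((1 - p1) + (1 - p2)) / 2%:R by field.
rewrite -subr_ge0 -(pmulr_rge0 _ (ltr0Sn C 1)) e e3.
move: (1 - p1) (1 - p2) h1 h2 {e e3} => x1 x2 h1 h2.
have h : 0 <= (x1 + x2) / 2%:R by rewrite divr_ge0 ?addr_ge0.
split; first exact: addr_ge0.
  by rewrite -addrA lerDl addr_ge0.
by rewrite [x1 + x2 in leRHS]addrC -addrA lerDl addr_ge0 // addrC.
Qed.

End Averages.

(** A nonzero string of weight at most 6 is the indicator of the entries of a 6-tuple of positions,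
    and n^6 + 1 <= 2 n^6. *)
Lemma card_lowwt n : (0 < n)%N -> (#|lowwt n| <= 2 * n ^ 6)%N.
Proof.
move=> n0.
pose ind (t : 6.-tuple 'I_n) : bits n := [ffun i => i \in t].
have sub : lowwt n \subset bzero n |: [set ind t | t in {: 6.-tuple 'I_n}].
  apply/subsetP => a; rewrite inE in_setU1 => wa.
  have [->//|/eqP a0] := eqVneq a (bzero n); apply/imsetP.
  have [x0 ax0] : exists i, a i.
    apply/existsP/negP => /existsP h; apply: a0; apply/ffunP => i; rewrite ffunE.
    by apply/negP => ai; apply: h; exists i.
  (* Short supports are padded with the default [x0], which already lies in the support. *)
  exists [tuple nth x0 (enum [pred i | a i]) k | k < 6] => //.
  apply/ffunP => i; rewrite ffunE; apply/idP/mapP => [ai|[k _ ->]].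
    have ie : i \in enum [pred i | a i] by rewrite mem_enum.
    have ik : (index i (enum [pred i | a i]) < 6)%N.
      by apply: leq_trans wa; rewrite /wt cardE index_mem.
    by exists (Ordinal ik); rewrite ?mem_enum //= nth_index.
  have [ks|ks] := ltnP k (size (enum [pred i | a i])); last by rewrite nth_default.
  by have := mem_nth x0 ks; rewrite mem_enum.
apply: leq_trans (subset_leq_card sub) _.
apply: leq_trans (leq_card_setU _ _) _; rewrite cards1 mul2n -addnn.
apply: leq_add; first by rewrite expn_gt0 n0.
by apply: leq_trans (leq_imset_card _ _) _; rewrite card_tuple card_ord.
Qed.

(** * From winning probabilities to consistency *)

Section PvmTranspose.
Variable C : numClosedFieldType.

Lemma pvm_mx_tr (O : finType) d (F : O -> 'M[C]_d) : pvm_mx F -> pvm_mx (fun o => (F o)^T).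
Proof.
move=> [hF iF sF]; split => [o|o|]; last by rewrite -raddf_sum sF /= trmx1.
  by apply/matrixP => i j; rewrite !mxE -[in RHS]hF !mxE.
by rewrite -trmx_mul iF.
Qed.

Lemma pvm_mx_entries (O : finType) d (P : O -> 'I_d -> 'I_d -> C) :
  (forall o i j, P o i j = (P o j i)^*) ->
  (forall o i j, \sum_k P o i k * P o k j = P o i j) ->
  (forall i j, \sum_o P o i j = (i == j)%:R) ->
  pvm_mx (fun o => \matrix_(i, j) P o i j).
Proof.
move=> hP iP sP; split => [o|o|]; apply/matrixP => i j.
- by rewrite !mxE -hP.
- by rewrite !mxE -[RHS]iP; apply: eq_bigr => k _; rewrite !mxE.
by rewrite summxE mxE -sP; apply: eq_bigr => o _; rewrite mxE.
Qed.

Lemma joint_entries dA dB (Psi : 'M[C]_(dA, dB)) (E : 'M[C]_dA) (F : 'M[C]_dB) :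
  joint Psi E F^T
  = \sum_i \sum_j (Psi i j)^* * \sum_c \sum_c' E i c * F j c' * Psi c c'.
Proof.
rewrite exchange_big; apply: eq_bigr => j _; rewrite mxE; apply: eq_bigr => i _.
rewrite !mxE; congr (_ * _); rewrite exchange_big; apply: eq_bigr => c' _.
by rewrite !mxE mulr_suml; apply: eq_bigr => c _; ring.
Qed.

Lemma obs_entries d (E : bool -> 'M[C]_d) i j :
  obs E id i j = E false i j - E true i j.
Proof. by rewrite /obs big_bool !mxE /= expr1 expr0 mulN1r mul1r addrC. Qed.

End PvmTranspose.

Definition to_mx d (A : mx 'I_d 'I_d) : 'M[CC]_d := \matrix_(i, j) A i j.

Lemma pvm_to_mx (O : finType) d (P : O -> mx 'I_d 'I_d) :
  is_pvm P -> pvm_mx (fun o => to_mx (P o)).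
Proof.
by move=> [hP sP]; apply: pvm_mx_entries => // o; have [] := hP o.
Qed.

Lemma to_mx_mmul d (A B : mx 'I_d 'I_d) : to_mx (mmul A B) = to_mx A *m to_mx B.
Proof.
by apply/matrixP => i j; rewrite !mxE; apply: eq_bigr => k _; rewrite !mxE.
Qed.

Lemma to_mx_mid d : to_mx (mid 'I_d) = 1%:M.
Proof. by apply/matrixP => i j; rewrite !mxE. Qed.

Lemma to_mx_mprod n d (M : 'I_n -> mx 'I_d 'I_d) (b : bits n) (c : bool) e
    (N : bool * 'I_n -> 'M[CC]_d) :
  (forall i, N (c, i) = to_mx (M i)) -> (forall i, e (c, i) = b i) ->
  to_mx (mprod M b) = word N e [seq (c, i) | i <- enum 'I_n].
Proof.
move=> hN he; rewrite /mprod enumT [index_enum _]unlock.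
elim: (Finite.enum _) => [|i s IH]; first by rewrite big_nil to_mx_mid /word big_nil.
rewrite big_cons /= word_cons he hN /slot -IH; case: (b i); last by rewrite mul1mx.
by rewrite to_mx_mmul.
Qed.

Section Strategy.
Variables (n dA dB : nat) (S : strategy n dA dB).
Hypothesis vS : valid_strategy S.

Definition state : 'M[CC]_(dA, dB) := state_mx (st S).
Definition alice (x : pstr n) (b : bool) := to_mx (A_str S x b).
Definition bob_lin (x x' : pstr n) (b : bool * bool) := (to_mx (B_lin S x x' b))^T.

Lemma norm2_state : norm2 state = 1.
Proof. by have [_ _ _ _ <-] := vS; rewrite norm2_state_mx. Qed.

Lemma pvm_alice x : pvm_mx (alice x).
Proof. by have [h _ _ _ _] := vS; apply: pvm_to_mx. Qed.

Lemma pvm_bob_lin x x' : pvm_mx (bob_lin x x').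
Proof. by have [_ _ h _ _] := vS; apply/pvm_mx_tr/pvm_to_mx. Qed.

Lemma probE E F : prob S E F = joint state (to_mx E) (to_mx F)^T.
Proof.
rewrite joint_entries /prob /inner pair_bigA; apply: eq_bigr => -[i j] _ /=.
rewrite mxE mapp_tens; apply: (f_equal2 (fun t u : CC => t * u)) => //.
by apply: eq_bigr => c _; apply: eq_bigr => c' _; rewrite !mxE.
Qed.

Lemma to_mx_tauA x : to_mx (tauA S x) = obs (alice x) id.
Proof. by apply/matrixP => i j; rewrite (@obs_entries CC) !mxE. Qed.

Lemma lin_loss W a a' :
  let x := Wstr W a in let x' := Wstr W a' in
  [/\ lin_win S W a a' <= 1,
      norm2 (obs (alice x) id *m state - state *m obs (bob_lin x x') fst)
        <= 12%:R * (1 - lin_win S W a a') &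
      norm2 (obs (alice x') id *m state - state *m obs (bob_lin x x') snd)
        <= 12%:R * (1 - lin_win S W a a')].
Proof.
move=> x x'; rewrite /lin_win -/x -/x'; set y := Wstr W _.
have e z (f : bool * bool -> bool) :
    \sum_b prob S (A_str S z (f b)) (B_lin S x x' b)
    = \sum_(b | predT b) joint state (alice z (f b)) (bob_lin x x' b).
  by apply: eq_bigr => b _; rewrite probE.
have le1 z f : \sum_b prob S (A_str S z (f b)) (B_lin S x x' b) <= 1.
  rewrite e -norm2_state; apply: sum_joint_le; [exact: pvm_alice|exact: pvm_bob_lin].
have dis z f : norm2 (obs (alice z) id *m state - state *m obs (bob_lin x x') f)
    <= 4%:R * (1 - \sum_b prob S (A_str S z (f b)) (B_lin S x x' b)).
  have := norm2_disagree_le state (pvm_alice z) (pvm_bob_lin x x') (P := predT) (fun b _ => erefl (f b)).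
  by rewrite norm2_state e.
have [h0 h1 h2] := three_loss (wt (bxor a a') <= 6)%N (le1 x fst) (le1 x' snd)
  (le1 y (fun b => addb b.1 b.2)).
have c12 (p q t : CC) : t <= 4%:R * p -> p <= 3%:R * q -> t <= 12%:R * q.
  move=> tp pq; apply: (le_trans tp).
  rewrite (_ : 12%:R = 4%:R * 3%:R :> CC); last by rewrite -natrM.
  by rewrite -mulrA ler_pM2l ?ltr0n.
split => //.
  exact: c12 (dis _ _) h1.
exact: c12 (dis _ _) h2.
Qed.

Section Pair.
Variables i j : 'I_n.

Definition square_pvm (v : msvar) (b : bool) : 'M[CC]_dA :=
  if is_v9 v then to_mx (A_v9 S i j b)
  else alice (two_str i j (Apair v).1 (Apair v).2) b.

Definition bob_ac (q : msline) s := (to_mx (B_ac S q i j s))^T.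

Lemma pvm_square v : pvm_mx (square_pvm v).
Proof.
rewrite /square_pvm; case: (is_v9 v); last exact: pvm_alice.
by have [_ h _ _ _] := vS; apply: pvm_to_mx.
Qed.

Lemma pvm_bob_ac q : pvm_mx (bob_ac q).
Proof. by have [_ _ _ h _] := vS; apply/pvm_mx_tr/pvm_to_mx. Qed.

(** On satisfying assignments [line_value] is the actual answer, so [norm2_disagree_le] applies with
    [P] the satisfying assignments. *)
Lemma ac_loss q t :
  ac_win S i j q t <= 1 /\
  norm2 (obs (square_pvm (var_of q t)) id *m state - state *m obs (bob_ac q) (line_value q t))
    <= 4%:R * (1 - ac_win S i j q t).
Proof.
have -> : ac_win S i j q t
   = \sum_(s | sat q s) joint state (square_pvm (var_of q t) (s t)) (bob_ac q s).
  rewrite /ac_win /square_pvm; apply: eq_bigr => s _.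
  by case: ifP => _; rewrite probE.
have pA := pvm_square (var_of q t); have pB := pvm_bob_ac q.
have := norm2_disagree_le state pA pB (P := sat q) (@line_value_sat q t).
have := sum_joint_le state pA pB (sat q) (fun s => s t).
by rewrite norm2_state.
Qed.

End Pair.

Lemma ac_test_le1 : ac_test S <= 1.
Proof.
apply: avgS_le1 => p _; apply: avgT_le1 => q; apply: avgT_le1 => t.
by have [] := ac_loss p.1 p.2 q t.
Qed.

Lemma lin_test_le1 : lin_test S <= 1.
Proof.
apply: avgT_le1 => W; apply: avgS_le1 => a _; apply: avgS_le1 => a' _.
by have [] := lin_loss W a a'.
Qed.

End Strategy.

(** * Constants of the error bounds *)

Section Bounds.
Variable C : numClosedFieldType.

Lemma half_loss (l a e : C) : l <= 1 -> a <= 1 -> (l + a) / 2%:R = 1 - e ->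
  1 - l <= 2%:R * e /\ 1 - a <= 2%:R * e.
Proof.
rewrite -(subr_ge0 l) -(subr_ge0 a) => l1 a1 h.
have -> : e = ((1 - l) + (1 - a)) / 2%:R.
  have -> : e = 1 - (l + a) / 2%:R by rewrite h opprB addrC subrK.
  by field.
rewrite mulrC divfK ?pnatr_eq0 // lerDl lerDr; split=> //.
Qed.

(** Here [l] is the number of low-weight strings and [m] is n^6; the constant is 12 * 4 * 2^2 * 2 =
    384. *)
Lemma lin_error_bound (t u v l m e : C) : 0 <= l -> 0 <= m -> 0 <= e ->
  t <= 12%:R * u -> u <= 4%:R * (l * l) * v -> v <= 2%:R * e -> l <= 2%:R * m ->
  t <= 384%:R * (m * m) * e.
Proof.
move=> l0 m0 e0 tu uv ve lm; apply: (le_trans tu).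
apply: (@le_trans _ _ (12%:R * (4%:R * ((2%:R * m) * (2%:R * m)) * (2%:R * e)))).
  rewrite ler_pM2l ?ltr0n //; apply: (le_trans uv).
  apply: (@le_trans _ _ (4%:R * (l * l) * (2%:R * e))).
    by apply: ler_wpM2l => //; rewrite !mulr_ge0.
  apply: ler_wpM2r; first by rewrite mulr_ge0.
  by rewrite ler_pM2l ?ltr0n //; apply: ler_pM.
by rewrite le_eqVlt; apply/orP; left; apply/eqP; ring.
Qed.

(** The factors multiply to 4 * 3 * 6 * 2 = 144, rounded up to 384 so that both tests share one
    bound. *)
Lemma ac_error_bound (t u a b v p m e : C) : 0 <= p -> 0 <= e ->
  t <= 4%:R * u -> u <= 3%:R * a -> a <= 6%:R * b -> b <= p * v ->
  v <= 2%:R * e -> p <= m -> t <= 384%:R * m * e.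
Proof.
move=> p0 e0 tu ua ab bp ve pm; apply: (le_trans tu).
have m0 := le_trans p0 pm.
apply: (@le_trans _ _ (4%:R * (3%:R * (6%:R * (m * (2%:R * e)))))).
  rewrite ler_pM2l ?ltr0n //; apply: (le_trans ua).
  rewrite ler_pM2l ?ltr0n //; apply: (le_trans ab).
  rewrite ler_pM2l ?ltr0n //; apply: (le_trans bp).
  apply: (@le_trans _ _ (p * (2%:R * e))); first exact: ler_wpM2l.
  by apply: ler_wpM2r => //; rewrite mulr_ge0.
have -> : 4%:R * (3%:R * (6%:R * (m * (2%:R * e)))) = 144%:R * (m * e) by ring.
by rewrite -mulrA; apply: ler_wpM2r; rewrite ?mulr_ge0 // ler_nat.
Qed.

(* Below the threshold [N ^ 12 * sqrt e <= 1] one factor [sqrt e] absorbs [N ^ 6]; above it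
   the trivial bound [4] suffices. *)
Lemma error_threshold (N t s : C) : 1 <= N -> 0 <= s ->
  t <= 4%:R -> t <= (129 ^ 2)%:R * N ^+ 6 * (384%:R * N ^+ 12 * s ^+ 2) ->
  t <= (129 ^ 2 * 384)%:R * N ^+ 12 * s.
Proof.
move=> N1 s0 t4 tN.
have N0 : 0 <= N by apply: le_trans ler01 N1.
have w0 : 0 <= N ^+ 12 * s by rewrite mulr_ge0 ?exprn_ge0.
have [h|h] := real_leP (ger0_real w0) (ger0_real ler01); last first.
  apply: (le_trans t4); rewrite -mulrA -[leLHS]mulr1; apply: ler_pM => //.
    by rewrite ler_nat.
  exact: ltW.
apply: (le_trans tN).
have -> : (129 ^ 2)%:R * N ^+ 6 * (384%:R * N ^+ 12 * s ^+ 2)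
  = (129 ^ 2 * 384)%:R * N ^+ 12 * s * (N ^+ 6 * s).
  by rewrite natrM; move: (129 ^ 2)%N 384%N => k l; ring.
rewrite -[leRHS]mulr1; apply: ler_wpM2l; first by rewrite -mulrA mulr_ge0.
by apply: le_trans h; apply: ler_wpM2r => //; apply: ler_weXn2l.
Qed.

End Bounds.

(** * Approximate relations between Alice's generators *)

Section Relations.
Variables (n dA dB : nat) (S : strategy n dA dB) (eps : CC).
Hypotheses (vS : valid_strategy S) (eps_ge0 : 0 <= eps) (win : winprob S = 1 - eps).
Hypothesis n_gt1 : (1 < n)%N.

Definition base : CC := 384%:R * n%:R ^+ 12 * eps.

Lemma base_ge0 : 0 <= base.
Proof. by rewrite !mulr_ge0 ?exprn_ge0 ?ler0n. Qed.

Lemma test_losses : 1 - lin_test S <= 2%:R * eps /\ 1 - ac_test S <= 2%:R * eps.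
Proof. exact: half_loss (lin_test_le1 vS) (ac_test_le1 vS) win. Qed.

Lemma close_base m k (U V : 'M[CC]_(m, k)) : norm2 (U - V) <= base -> close base 1 U V.
Proof. by rewrite /close exp1n mul1r. Qed.

Lemma Wstr_local (W W' a : bits n) : (forall t, a t -> W t = W' t) -> Wstr W a = Wstr W' a.
Proof.
by move=> h; apply/ffunP => t; rewrite !ffunE; case at_: (a t) => //; rewrite h.
Qed.

Lemma ebit_lowwt (i : 'I_n) : ebit i \in lowwt n.
Proof.
rewrite inE /wt (@eq_card _ _ (pred1 i)) ?card1 // => t.
by rewrite !inE ffunE.
Qed.

Lemma lin_consistent W i j :
  let x := Wstr W (ebit i) in let x' := Wstr W (ebit j) in
  close base 1 (obs (alice S x) id *m state S) (state S *m obs (bob_lin S x x') fst) /\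
  close base 1 (obs (alice S x') id *m state S) (state S *m obs (bob_lin S x x') snd).
Proof.
move=> x x'; have [_ hf hs] := lin_loss vS W (ebit i) (ebit j).
have le1 W' a a' : lin_win S W' a a' <= 1 by have [] := lin_loss vS W' a a'.
have [hl _] := test_losses.
pose L : CC := #|lowwt n|%:R.
have hloc : 1 - lin_win S W (ebit i) (ebit j) <= 4%:R * (L * L) * (1 - lin_test S).
  (* At this question [lin_win] depends on [W] only at [i] and [j], so fixing [W] costs a factor 4
     instead of 2^n. *)
  apply: (@avgT_local_loss CC n (fun W => lin_win S W (ebit i) (ebit j)) _ (L * L) i j W) => //.
    move=> W1 W2 ei ej; rewrite /lin_win !(@Wstr_local W1 W2) //.
    - move=> t; rewrite !ffunE; case: eqP => [->|_] //=; by case: eqP => // ->.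
    - by move=> t; rewrite ffunE => /eqP ->.
    by move=> t; rewrite ffunE => /eqP ->.
  move=> W'.
  apply: (le_trans (@avgS_loss CC _ (lowwt n) (lin_win S W' (ebit i)) (fun _ _ => le1 _ _ _) _ (ebit_lowwt j))).
  rewrite -mulrA; apply: ler_wpM2l; first exact: ler0n.
  apply: (@avgS_loss CC _ (lowwt n) (fun a => avgS (lowwt n) (lin_win S W' a)) _ _ (ebit_lowwt i)) => a _.
  by apply: avgS_le1.
have hL : L <= 2%:R * n%:R ^+ 6.
  by rewrite -natrX -natrM ler_nat card_lowwt // ltnW.
have hb : base = 384%:R * (n%:R ^+ 6 * n%:R ^+ 6) * eps by rewrite -exprD.
have m0 : 0 <= (n%:R : CC) ^+ 6 by rewrite exprn_ge0 ?ler0n.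
split; apply: close_base; rewrite hb.
  exact: (@lin_error_bound CC _ _ _ L _ eps (ler0n _ _) m0 eps_ge0 hf hloc hl hL).
exact: (@lin_error_bound CC _ _ _ L _ eps (ler0n _ _) m0 eps_ge0 hs hloc hl hL).
Qed.

Lemma ac_consistent (i j : 'I_n) q t : (i < j)%N ->
  close base 1 (obs (square_pvm S i j (var_of q t)) id *m state S)
    (state S *m obs (bob_ac S i j q) (line_value q t)).
Proof.
move=> ij; have [_ h] := ac_loss vS i j q t.
have le1 i' j' q' t' : ac_win S i' j' q' t' <= 1 by have [] := ac_loss vS i' j' q' t'.
have [_ hl] := test_losses; apply: close_base.
have ijP : (i, j) \in pairs n by rewrite inE.
pose f1 p := avgT (fun q : msline => avgT (fun t : 'I_3 => ac_win S p.1 p.2 q t)).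
have f1_le1 p : f1 p <= 1 by apply: avgT_le1 => q'; apply: avgT_le1.
have h1 : 1 - f1 (i, j) <= #|pairs n|%:R * (1 - ac_test S).
  exact: (@avgS_loss CC _ (pairs n) f1 (fun p _ => f1_le1 p) _ ijP).
have h2 : 1 - avgT (ac_win S i j q) <= 6%:R * (1 - f1 (i, j)).
  have c6 : #|{: msline}| = 6%N by rewrite card_prod card_bool card_ord.
  by rewrite -c6; apply: (@avgT_loss CC _ (fun q => avgT (ac_win S i j q))) => q'; apply: avgT_le1.
have h3 : 1 - ac_win S i j q t <= 3%:R * (1 - avgT (ac_win S i j q)).
  have c3 : #|{: 'I_3}| = 3%N by rewrite card_ord.
  by rewrite -[X in X%:R * _]c3; apply: (@avgT_loss CC _ (ac_win S i j q)).
have hp : (#|pairs n|%:R : CC) <= n%:R ^+ 12.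
  rewrite -natrX ler_nat; apply: leq_trans (max_card _) _.
  by rewrite card_prod card_ord mulnn leq_pexp2l // ltnW.
exact: (@ac_error_bound CC _ _ _ _ _ _ _ eps (ler0n _ _) eps_ge0 h h3 h2 h1 hl hp).
Qed.

Definition letter (c : bool) : pauli := if c then pZ else pX.

Definition alice_gen (p : bool * 'I_n) : 'M[CC]_dA := obs (alice S (single p.2 (letter p.1))) id.

Definition bob_gen (p : bool * 'I_n) : 'M[CC]_dB :=
  let x := single p.2 (letter p.1) in obs (bob_lin S x x) fst.

Lemma Wstr_ebit (W : bits n) i : Wstr W (ebit i) = single i (letter (W i)).
Proof. by apply/ffunP => t; rewrite !ffunE; case: eqP => // ->. Qed.

Lemma alice_gen_unitary p : alice_gen p \is unitarymx.
Proof. exact/obs_unitary/pvm_alice. Qed.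

Lemma gen_consistent p : close base 1 (alice_gen p *m state S) (state S *m bob_gen p).
Proof.
have [h _] := lin_consistent [ffun=> p.1] p.2 p.2.
by rewrite Wstr_ebit ffunE in h.
Qed.

(** Bob's two answers come from one measurement, so their observables commute exactly. Four uses of
    consistency suffice; 24 matches [gen_anticommute]. *)
Lemma gen_commute p q : p.2 != q.2 ->
  close base 24 (alice_gen p *m (alice_gen q *m state S)) (alice_gen q *m (alice_gen p *m state S)).
Proof.
(* [W] has the required types at the two qubits, so one question to Bob asks for both generators. *)
move=> pq; pose W : bits n := [ffun t => if t == p.2 then p.1 else q.1].
have [] := lin_consistent W p.2 q.2.
rewrite !Wstr_ebit !ffunE eqxx eq_sym (negbTE pq) -/(alice_gen p) -/(alice_gen q).
set x := single _ _; set y := single _ _ => hp hq.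
have pF := pvm_bob_lin vS x y.
apply: (@close_le _ _ base_ge0 4) => //.
apply: (close_trans (k := 1) (l := 3) (close_mull (alice_gen_unitary p) hq)); rewrite mulmxA.
apply: (close_trans (k := 1) (l := 2) (close_mulr (obs_unitary pF _) hp)).
rewrite -mulmxA obs_mul // (eq_obs _ (fun o => addbC (fst o) (snd o))) -obs_mul // mulmxA.
apply: (close_trans (k := 1) (l := 1) (close_mulr (obs_unitary pF _) (close_sym hq))).
rewrite -mulmxA; apply: close_mull; first exact: alice_gen_unitary.
exact: close_sym.
Qed.

(** A second qubit [j] completes a magic square in which [i] is the first or the second qubit
    according to the order of [i] and [j]; this is where both halves of [magic_square_swap]
    enter. *)
Lemma gen_anticommute i :
  close base 24 (alice_gen (true, i) *m (alice_gen (false, i) *m state S))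
    (- (alice_gen (false, i) *m (alice_gen (true, i) *m state S))).
Proof.
have sq (k l : 'I_n) : (k < l)%N -> _ := fun kl =>
  @magic_square_swap CC base _ _ (fun v => obs (square_pvm S k l v) id) (state S)
    (bob_ac S k l) (fun v => obs_unitary (pvm_square vS k l v) _)
    (pvm_bob_ac vS k l) (fun q t => ac_consistent q t kl).
have T k l v x : is_v9 v = false -> two_str k l (Apair v).1 (Apair v).2 = x ->
    obs (square_pvm S k l v) id = obs (alice S x) id.
  by move=> h9 <-; rewrite /square_pvm h9.
have sL (k l : 'I_n) P : k != l -> two_str k l P pI = single k P.
  by move=> kl; apply/ffunP => t; rewrite !ffunE; case: eqP => // _; case: eqP.
have sR (k l : 'I_n) P : k != l -> two_str k l pI P = single l P.
  move=> kl; apply/ffunP => t; rewrite !ffunE; case: eqP => [->|_] //.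
  by rewrite (negbTE kl).
have [j ij] : exists j : 'I_n, j != i.
  have h0 : (0 < n)%N by apply: ltnW.
  have [i0|i0] := eqVneq (val i) 0%N.
    by exists (Ordinal n_gt1); rewrite -val_eqE /= i0.
  by exists (Ordinal h0); rewrite -val_eqE /= eq_sym.
have [ltij|] := ltnP i j.
  have [h _] := sq i j ltij; rewrite eq_sym in ij.
  have eZ := T i j (0, 1) _ erefl (sL i j pZ ij).
  have eX := T i j (1, 0) _ erefl (sL i j pX ij).
  by rewrite eZ eX in h.
rewrite leq_eqVlt val_eqE (negbTE ij) => /= ltji.
have [_ h] := sq j i ltji.
have eZ := T j i (0, 0) _ erefl (sR j i pZ ij).
have eX := T j i (1, 1) _ erefl (sR j i pX ij).
by rewrite eZ eX in h.
Qed.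

Lemma gen_swap p q : p != q ->
  close base 24 (alice_gen p *m (alice_gen q *m state S))
    ((-1) ^+ anti p q *: (alice_gen q *m (alice_gen p *m state S))).
Proof.
case: p q => c i [c' j]; rewrite /anti xpair_eqE /=.
have [<-|ij] := eqVneq i j; last by rewrite !andbF expr0 scale1r => _; exact: gen_commute.
rewrite !andbT => cc; rewrite cc expr1 scaleN1r.
case: c c' cc => -[] // _; first exact: gen_anticommute.
have := close_sign true (close_sym (gen_anticommute i)).
by rewrite !scaleN1r opprK.
Qed.

End Relations.

(** * Assembly of the estimates *)

Lemma defect_le4 (C : numClosedFieldType) n dA dB (UA : bits n -> bits n -> 'M[C]_dA)
    (UB : bits n -> bits n -> 'M[C]_dB) (Psi : 'M[C]_(dA, dB)) a b x z x' z' :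
  (forall x z, UA x z \is unitarymx) -> (forall x z, UB x z \is unitarymx) ->
  norm2 Psi = 1 -> norm2 (defect UA UB Psi a b x z x' z') <= 4%:R.
Proof.
move=> uA uB P1; apply: (le_trans (norm2_sub _ _)).
rewrite norm2Z normrX normrN1 !expr1n mul1r norm2_unitaryl ?trmxC_unitary //.
by rewrite !norm2_unitaryl // norm2_unitaryr // P1 -[1 + 1]/(2%:R) -natrM.
Qed.

Lemma fA_pword n dA dB (S : strategy n dA dB) alpha x z i j :
  fA S (alpha, x, z) i j = (-1) ^+ alpha * pword (alice_gen S) x z i j.
Proof.
rewrite /fA sgnE; apply: (f_equal2 (fun t u : CC => t * u)) => //.
have hM (c : bool) k : alice_gen S (c, k) = to_mx (tauA S (single k (letter c))).
  by rewrite to_mx_tauA.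
rewrite /pword /gens word_cat.
rewrite -(@to_mx_mprod n dA (fun k => tauA S (single k pX)) x false) //.
rewrite -(@to_mx_mprod n dA (fun k => tauA S (single k pZ)) z true) //.
by rewrite -to_mx_mmul mxE.
Qed.

Theorem theorem4p9 :
  exists Cst : CC, 0 < Cst /\
  forall (n : nat) (eps : CC) (dA dB : nat) (S : strategy n dA dB),
    (2 <= n)%N -> 0 <= eps -> valid_strategy S -> winprob S = 1 - eps ->
    exists (eA eB : nat) (VA : mx (bits n * 'I_eA)%type 'I_dA)
           (VB : mx (bits n * 'I_eB)%type 'I_dB) (aux : vec ('I_eA * 'I_eB)%type),
      [/\ is_isometry VA, is_isometry VB, vnorm2 aux = 1 &
      forall g : heis n,
        vnorm2 (fun p : ((bits n * bits n) * ('I_eA * 'I_eB))%type =>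
          mapp (tens VA VB) (mapp (tens (fA S g) (mid 'I_dB)) (st S))
               ((p.1.1, p.2.1), (p.1.2, p.2.2))
          - mapp (tens (sigma g) (mid (bits n))) (epr n) p.1 * aux p.2)
        <= Cst * n%:R ^+ 12 * sqrtC eps].
Proof.
(* The count of 129 n^3 basic errors enters squared; 384 is the constant of [base]. *)
exists (129 ^ 2 * 384)%:R; split; first by rewrite ltr0n.
move=> n eps dA dB S n2 e0 vS win.
have uA p : alice_gen S p \is unitarymx by exact: alice_gen_unitary.
have uB p : bob_gen S p \is unitarymx by exact/obs_unitary/pvm_bob_lin.
have uwA x z : pword (alice_gen S) x z \is unitarymx by exact: word_unitary.
have uwB x z : pword (bob_gen S) x z \is unitarymx by exact: word_unitary.
have v1 : vnorm2 (st S) = 1 by have [] := vS.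
have hbeta a b x z x' z' :
    norm2 (defect (pword (alice_gen S)) (pword (bob_gen S)) (state S) a b x z x' z')
    <= (129 ^ 2 * 384)%:R * n%:R ^+ 12 * sqrtC eps.
  apply: error_threshold.
  - by rewrite ler1n; apply: ltnW.
  - by rewrite sqrtC_ge0.
  - by apply: defect_le4 => //; exact: norm2_state.
  have sqr p : alice_gen S p *m alice_gen S p = 1%:M by apply: obs_sqr; exact: pvm_alice.
  (* The left side is 32 n^3 + 192 n^2 + 2 n, which at n = 2 is 1028, just below 129 * 8 = 1032. *)
  have hK : (2 * n + 2 * (2 * n * (2 * n * (24 + 2 * (2 * n)))) <= 129 * n ^ 3)%N by nia.
  have := pword_conj_mul (base_ge0 n e0) uA uB sqr (gen_consistent vS e0 win n2)
    (gen_swap vS e0 win n2) a b x z x' z'.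
  move/(close_le (base_ge0 n e0) hK) => h; rewrite sqrtCK; apply: (le_trans h).
  have e6 : (3 * 2 = 6)%N by [].
  by rewrite expnMn -expnM natrM [(n ^ _)%:R]natrX e6 /base lexx.
have [eA [eB [VA [VB [aux [isoA isoB aux1 herr]]]]]] := epr_rounding uwA uwB v1 hbeta.
exists eA, eB, VA, VB, aux; split; [exact: isoA|exact: isoB|exact: aux1|].
move=> [[alpha x] z]; apply: (herr alpha x z (fA S (alpha, x, z))) => i j.
exact: fA_pword.
Qed.
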